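(* Let $\Delta$ be a thick compact $m$-gon with $m \geq 3$ and let $C, C'$ be opposite chambers of $\Delta$. There exists $\varepsilon > 0$ such that the set $$L_\varepsilon(C,C') := \left\{ \varphi \in \mathrm{Auttop}(\Delta) \mid \rho(X, \varphi (X)) \leq \varepsilon \ \ \forall X \in E_1(C) \cup \{C'\} \right\}$$ is compact, where $\rho$ is some fixed metric inducing the topology on $\mathrm{Cham}\,\Delta$ and $E_1(C)$ denotes the set of chambers adjacent to $C$.
   Context: An $m$-gon is a spherical building $\Delta$ of rank $2$ and diameter $m$, viewed as a simplicial complex (a graph) with vertex set $\mathrm{Vert}\,\Delta$ and set of chambers (edges) $\mathrm{Cham}\,\Delta$. Two chambers are adjacent if they share a vertex; two chambers are opposite if they are at maximal gallery distance $m$. $\Delta$ is thick if each vertex lies in at least three chambers. $\Delta$ is a compact $m$-gon if $\mathrm{Vert}\,\Delta$ carries a compact (metrizable) topology such that $\mathrm{Cham}\,\Delta$ is closed in $(\mathrm{Vert}\,\Delta)^2$, chambers being viewed as pairs of vertices ordered by type; $\mathrm{Cham}\,\Delta$ gets the induced topology. $\mathrm{Auttop}(\Delta)$ is the group of automorphisms of $\Delta$ that restrict to homeomorphisms of $\mathrm{Vert}\,\Delta$ and of $\mathrm{Cham}\,\Delta$, with the topology induced from the compact-open topology on $C(\mathrm{Cham}\,\Delta,\mathrm{Cham}\,\Delta)$ (equivalently, the topology of uniform convergence on $\mathrm{Cham}\,\Delta$). *)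

(* Defs.v *)
(* MathComp-Analysis; the real numbers are an arbitrary [R : realType]. *)
From HB Require Import structures.
From mathcomp Require Import all_boot all_order all_algebra.
From mathcomp Require Import all_classical all_reals all_analysis.

Set Implicit Arguments.
Unset Strict Implicit.
Unset Printing Implicit Defensive.
Import Order.TTheory GRing.Theory Num.Theory.
Local Open Scope classical_set_scope.
Local Open Scope ring_scope.

(* A simplicial complex of dimension at most 1.  Subcomplexes (such as
   apartments) are complexes over the same ambient type [V]. *)
Record complex (V : Type) := Complex {
  vertices : set V ;
  edge : V -> V -> Prop ;
  edge_vertices : forall x y, edge x y -> vertices x ;
  edge_sym : forall x y, edge x y -> edge y x ;
  edge_irrefl : forall x, ~ edge x x
}.

(* The nonempty simplices {x, y}: vertices (x = y) and edges (x <> y). *)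
Definition simplex (V : Type) (K : complex V) (x y : V) : Prop :=
  (x = y /\ vertices K x) \/ edge K x y.

Definition subcomplex (V : Type) (K L : complex V) : Prop :=
  vertices K `<=` vertices L /\ (forall x y, edge K x y -> edge L x y).

Definition complex_iso (V : Type) (K L : complex V) (f : V -> V) : Prop :=
  set_bij (vertices K) (vertices L) f /\
  (forall x y, vertices K x -> vertices K y ->
     (edge K x y <-> edge L (f x) (f y))).

Definition circuit (V : Type) (n : nat) (K : complex V) : Prop :=
  exists a : 'I_n -> V,
    [/\ injective a, vertices K = range a &
        forall x y, edge K x y <->
          exists i : 'I_n, (x = a i /\ y = a (ordS i)) \/
                           (y = a i /\ x = a (ordS i))].

(* The finite Coxeter groups of rank 2 are the dihedral groups of order 2k,
   k >= 2; the Coxeter complex of that group is the circuit of length 2k. *)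
Definition spherical_coxeter_complex2 (V : Type) (K : complex V) : Prop :=
  exists2 k : nat, (2 <= k)%N & circuit k.*2 K.

(* Spherical buildings of rank 2, not necessarily thick.  The requirements
   involving the empty simplex follow from those stated here. *)
Definition apartment_system (V : Type) (K : complex V)
    (Apt : set (complex V)) : Prop :=
  [/\ forall A, Apt A -> subcomplex A K /\ spherical_coxeter_complex2 A,
      forall x y z w, simplex K x y -> simplex K z w ->
        exists A, [/\ Apt A, simplex A x y & simplex A z w] &
      forall A B x y z w, Apt A -> Apt B ->
        simplex A x y -> simplex A z w -> simplex B x y -> simplex B z w ->
        exists f, complex_iso A B f /\ [/\ f x = x, f y = y, f z = z & f w = w]].

Definition spherical_building2 (V : Type) (K : complex V) : Prop :=
  exists Apt, apartment_system K Apt.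

(* [V] itself is the vertex set.  The type function is part of the data; for a
   rank 2 building it exists and is unique up to exchanging the two types. *)
Record typed_complex (V : Type) := TypedComplex {
  complex_of :> complex V ;
  verticesT : vertices complex_of = setT ;
  vtype : V -> bool ;
  vtypeP : forall x y, edge complex_of x y -> vtype x != vtype y
}.

(* Edges, as pairs of vertices ordered by type.  Coerced to a type, this set
   carries the topology induced by the product topology of [V * V]. *)
Definition Cham (V : Type) (D : typed_complex V) : set (V * V) :=
  [set c | [/\ edge D c.1 c.2, vtype D c.1 = false & vtype D c.2 = true]].

Section chambers.
Variables (V : Type) (D : typed_complex V).

Definition in_chamber (x : V) (X : Cham D) : Prop :=
  x = (set_val X).1 \/ x = (set_val X).2.

Definition adjacent (X Y : Cham D) : Prop :=
  exists x, in_chamber x X /\ in_chamber x Y.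

(* [adjacent] is reflexive, so [E1 C] contains [C]. *)
Definition E1 (C : Cham D) : set (Cham D) := [set X | adjacent C X].

Definition gallery (n : nat) (X Y : Cham D) : Prop :=
  exists g : nat -> Cham D, [/\ g 0%N = X, g n = Y &
    forall i, (i < n)%N -> adjacent (g i) (g i.+1)].

Definition gallery_dist_eq (X Y : Cham D) (n : nat) : Prop :=
  gallery n X Y /\ (forall k, (k < n)%N -> ~ gallery k X Y).

Definition opposite (m : nat) (X Y : Cham D) : Prop := gallery_dist_eq X Y m.

Definition diameter_eq (m : nat) : Prop :=
  (forall X Y, exists2 n, (n <= m)%N & gallery_dist_eq X Y n) /\
  (exists X Y, gallery_dist_eq X Y m).

Definition thick : Prop :=
  forall x : V, exists X Y Z : Cham D,
    [/\ X <> Y, Y <> Z & X <> Z] /\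
    [/\ in_chamber x X, in_chamber x Y & in_chamber x Z].

Definition mgon (m : nat) : Prop := spherical_building2 D /\ diameter_eq m.

(* Automorphisms of the simplicial complex; they may exchange the two types. *)
Record automorphism := Automorphism {
  aut_fun :> V -> V ;
  aut_iso : complex_iso D D aut_fun
}.

Definition cham_pair (f : V -> V) (c : V * V) : V * V :=
  if vtype D (f c.1) then (f c.2, f c.1) else (f c.1, f c.2).

Lemma cham_pairP (f : automorphism) (X : Cham D) :
  cham_pair f (set_val X) \in Cham D.
Proof.
have all x : vertices D x by rewrite verticesT.
have [_ fE] := aut_iso f.
apply/mem_set; have : Cham D (set_val X) by exact: set_valP.
move: (set_val X) => -[x y] [/= exy _ _].
have e := iffLR (fE x y (all x) (all y)) exy.
have := vtypeP e; rewrite /cham_pair /Cham /=.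
case Ex: (vtype D (f x)); case Ey: (vtype D (f y)) => // _; split => //=.
exact: edge_sym.
Qed.

Definition cham_map (f : automorphism) (X : Cham D) : Cham D :=
  exist _ (cham_pair f (set_val X)) (cham_pairP f X).

End chambers.

Definition homeomorphism (S T : topologicalType) (f : S -> T) : Prop :=
  exists g : T -> S, [/\ cancel f g, cancel g f, continuous f & continuous g].

Definition metric_inducing_topology (R : realType) (T : topologicalType)
    (d : T -> T -> R) : Prop :=
  [/\ forall x y, d x y = 0 <-> x = y,
      forall x y, d x y = d y x,
      forall x y z, d x z <= d x y + d y z &
      forall (x : T) (A : set T),
        nbhs x A <-> exists2 e : R, 0 < e & [set y | d x y < e] `<=` A].

Definition metrizable (R : realType) (T : topologicalType) : Prop :=
  exists d : T -> T -> R, metric_inducing_topology d.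

Section topological.
Variables (V : topologicalType) (D : typed_complex V).

Definition compact_mgon (R : realType) (m : nat) : Prop :=
  [/\ mgon D m, compact [set: V], metrizable R V & closed (Cham D)].

(* Topologized below by the compact-open topology on maps of [Cham D]; the set
   of all such maps is used, as [auttop_map] takes only continuous values. *)
Record Auttop := MkAuttop {
  auttop_aut :> automorphism D ;
  auttop_vert : homeomorphism (auttop_aut : V -> V) ;
  auttop_cham : homeomorphism (cham_map auttop_aut)
}.

Definition auttop_map (phi : Auttop) : {compact-open, Cham D -> Cham D} :=
  cham_map phi.

HB.instance Definition _ := gen_eqMixin Auttop.
HB.instance Definition _ := gen_choiceMixin Auttop.
HB.instance Definition _ :=
  Topological.copy Auttop (initial_topology auttop_map).

Definition L_set (R : realType) (rho : Cham D -> Cham D -> R)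
    (C C' : Cham D) (eps : R) : set Auttop :=
  [set phi | forall X : Cham D,
     (E1 C `|` [set C']) X -> rho X (cham_map phi X) <= eps].

End topological.

(* Main.v *)
(* For a sequence [f_n] in [L_eps] and a nonprincipal ultrafilter on [nat], the
   two maps [S x = lim x_n] and [T x = lim (f_n x_n)] from sequences of vertices
   to vertices preserve incidence, and equicontinuity of [f_n] and of their
   inverses says that [S x = S y] if and only if [T x = T y].  Suppose this fails
   for [b, b0] in the panel of a vertex of [C], say [S b = S b0], [T b <> T b0].
   Perspectivities define a product [(b, x) |-> y] between panels.  At [b] it
   degenerates under [S], being constant off one point, but not under [T].  Since
   [S] and [T] are [eps]-close on [E_1(C)], this forces [S x] to be a locally
   constant function of [T x] on a panel, so by compactness that panel is finite;
   but a finite panel is discrete, and finiteness of one panel entails that of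
   all others.  Hence the equivalence holds on the two panels of [C], it spreads
   along pairs of opposite vertices to all panels and then to all sequences, and
   [L_eps] is compact by the Arzela-Ascoli argument. *)

Require Import Defs.
From HB Require Import structures.
From mathcomp Require Import all_boot all_order all_algebra.
From mathcomp Require Import all_classical all_reals all_analysis.
From mathcomp Require Import zify lra.

Set Implicit Arguments.
Unset Strict Implicit.
Unset Printing Implicit Defensive.
Import Order.TTheory GRing.Theory Num.Theory.
Local Open Scope classical_set_scope.
Local Open Scope nat_scope.

(** In a limit, distances of the incidence graph can only drop, and their parity is fixed by the
    types. Hence a limit distance [m] or [m.-1] is already attained by almost all terms, and there
    projections commute with limits; this is why every construction passes through opposite
    vertices. The chamber [C'] supplies them: its vertices are opposite those of [C] and stay so
    after a small displacement, hence under both [S] and [T]. Perspectivities produce the other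
    opposite pairs, provided that three neighbours of a vertex have distinct images under both maps;
    near [C] this is arranged by the choice of [eps].

    The transfer of finiteness between panels is not formal when [m] is even: opposite vertices then
    have the same type, and no chain of perspectivities joins panels of different types. Injective
    sequences converging to a prescribed point, which compactness provides, take their place.

    Equicontinuity of the inverses is the same assertion with [S] and [T] exchanged, both being
    instances of one construction. *)

(** * Generalized polygons *)

(* A thick generalized [m]-gon, given by the distance [d] of its incidence graph;
   two vertices are incident when [d x y = 1]. *)
Record polygon (V : Type) (d : V -> V -> nat) (m : nat) : Prop := Polygon {
  pg_m : (3 <= m)%N ;
  pg_sym : forall x y, d x y = d y x ;
  pg_eq : forall x y, d x y = 0%N -> x = y ;
  pg_refl : forall x, d x x = 0%N ;
  pg_le : forall x y, (d x y <= m)%N ;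
  pg_step : forall x y z, d x y = 1%N ->
    d x z = (d y z).+1 \/ d y z = (d x z).+1 ;
  pg_near : forall x y, (0 < d x y)%N ->
    exists z, d x z = 1%N /\ (d z y).+1 = d x y ;
  pg_uniq : forall x y z z', d x z = 1%N -> d x z' = 1%N ->
    (d z y < d x y)%N -> (d z' y < d x y)%N -> (d x y < m)%N -> z = z' ;
  pg_thick : forall x a b, exists c, [/\ d x c = 1%N, c <> a & c <> b]
}.

Section polygon_theory.
Variables (V : Type) (d : V -> V -> nat) (m : nat).
Hypothesis P : polygon d m.

Let m3 : (3 <= m)%N := pg_m P.
Let dC := pg_sym P.
Let dle := pg_le P.
Let step := pg_step P.

(* The neighbour of [x] closest to [y]: unique if [0 < d x y < m], arbitrary if
   [d x y = m], and the junk value [x] if [x = y]. *)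
Definition pr (x y : V) : V :=
  if pselect (exists z, d x z = 1%N /\ (d z y).+1 = d x y) is left h
  then projT1 (cid h) else x.

Lemma prP x y : (0 < d x y)%N -> d x (pr x y) = 1%N /\ (d (pr x y) y).+1 = d x y.
Proof.
move=> /(pg_near P) h; rewrite /pr; case: pselect => // h'.
exact: (projT2 (cid h')).
Qed.

Lemma prE (x y z : V) : d x z = 1%N -> (d z y < d x y)%N -> (d x y < m)%N ->
  z = pr x y.
Proof.
move=> xz zy xym; have [xp py] := prP (leq_ltn_trans (leq0n _) zy).
by apply: (pg_uniq P xz xp zy _ xym); lia.
Qed.

Lemma pr_far x y z : d x z = 1%N -> z <> pr x y -> (d x y < m)%N ->
  d z y = (d x y).+1.
Proof.
move=> xz zn xym; case: (step y xz) => // e; exfalso; apply: zn.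
by apply: prE => //; rewrite e.
Qed.

Lemma opp_adj x y z : d x y = m -> d x z = 1%N -> d z y = m.-1.
Proof. by move=> xy /(step y); have := dle z y; lia. Qed.

Lemma persp_adj x y z : d x y = m -> d x z = 1%N ->
  [/\ d y (pr y z) = 1%N, d (pr y z) z = m.-2 & d (pr y z) x = m.-1].
Proof.
move=> xy xz; have zy := opp_adj xy xz.
have [|yp pz] := @prP y z; first by rewrite dC; lia.
split => //; first by rewrite dC in zy; lia.
by apply: opp_adj yp; rewrite dC.
Qed.

Lemma perspK x y z : d x y = m -> d x z = 1%N -> pr x (pr y z) = z.
Proof.
move=> xy xz; have [yp pz px] := persp_adj xy xz.
by apply/esym/prE => //; have := dC x (pr y z); have := dC z (pr y z); lia.
Qed.

Lemma persp_inj x y z z' : d x y = m -> d x z = 1%N -> d x z' = 1%N ->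
  pr y z = pr y z' -> z = z'.
Proof. by move=> xy xz xz' e; rewrite -(perspK xy xz) e perspK. Qed.

Lemma perspE x y z w : d x y = m -> d x z = 1%N -> d y w = 1%N ->
  (d w z <= m.-2)%N -> w = pr y z.
Proof.
by move=> xy xz yw wz; have zy := opp_adj xy xz; apply: prE => //;
  have := dC y z; lia.
Qed.

(** [z] is the projection of [pr y z] to [x], so any other neighbour of [x] is farther from
    [pr y z], hence opposite. This is the main source of new opposite pairs. *)
Lemma persp_opp x y z w : d x y = m -> d x z = 1%N -> d x w = 1%N -> z <> w ->
  d (pr y z) w = m.
Proof.
move=> xy xz xw zw; have [yp pz px] := persp_adj xy xz.
have := step (pr y z) xw; rewrite (dC x) (dC w) px => -[e|]; last lia.
by case: zw; apply: (pg_uniq P xz xw (y := pr y z));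
  have := dC x (pr y z); have := dC z (pr y z); have := dC w (pr y z); lia.
Qed.

Lemma approach u v : (d u v <= m.-1)%N ->
  exists w, d u w = 1%N /\ (d w v <= m.-2)%N.
Proof.
move=> h; have [e|uv] := posnP (d u v).
  have {}e := pg_eq P e; have [c [c1 _ _]] := pg_thick P u u u.
  by exists c; split => //; rewrite -e; have := dC c u; lia.
by have [up] := prP uv; exists (pr u v); split => //; lia.
Qed.

Lemma extend x y : (d x y < m)%N -> exists z, d y z = 1%N /\ d x z = (d x y).+1.
Proof.
move=> xy; have [c [yc cp _]] := pg_thick P y (pr y x) (pr y x).
by exists c; split => //; rewrite !(dC x) (pr_far yc cp) // dC.
Qed.

Lemma triangle x y z : (d x z <= d x y + d y z)%N.
Proof.
move e : (d x y) => n; elim: n x e => [|n IH] x e.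
  by rewrite (pg_eq P e).
have [xp py] := prP (y := y) (x := x) ltac:(lia).
by have := IH (pr x y); have := step z xp; lia.
Qed.

Lemma extend_to x y k : (d x y + k <= m)%N ->
  exists z, d x z = (d x y + k)%N /\ d y z = k.
Proof.
elim: k => [|k IH] xyk; first by exists y; rewrite (pg_refl P); lia.
have [|z [xz yz]] := IH; first lia.
have [|w [zw xw]] := @extend x z; first lia.
exists w; split; first lia.
by have := step y zw; have := triangle x y w; rewrite (dC z) (dC w); lia.
Qed.

Lemma ex_opp x : exists y, d x y = m.
Proof.
have [|y [+ _]] := @extend_to x x m; rewrite (pg_refl P) //.
by exists y.
Qed.

(** The configuration in which the product is formed. [K] is chosen so that [b] is its projection to
    [p]: it is opposite to [q] and to every neighbour of [p] except [b]. The vertex [o] is the value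
    to which the product degenerates over [b], and [p = pr q o] says that this value, brought back
    to [link q], is [p]. *)
Lemma frame p q b M x' : d p q = 1%N -> d p b = 1%N -> q <> b ->
    d q M = m -> d b M = m -> d q x' = 1%N -> x' <> p ->
  let x := pr M x' in let K := pr x b in let o := pr K b in
  [/\ d M x = 1%N, d x b = m.-1, d x K = 1%N, d K b = m.-2 & d K p = m.-1] /\
  [/\ d q K = m, d K o = 1%N, (d o b <= m - 3)%N & p = pr q o].
Proof.
move=> pq pb qb qM bM qx' xp x K o; have qp : d q p = 1%N by rewrite dC.
have [Mx xx' xq] := persp_adj qM qx'; rewrite -/x in Mx xx' xq.
have xb : d x b = m.-1 by apply: (opp_adj (x := M)); rewrite // dC.
have [|xK Kb] := @prP x b; first lia.
have {}Kb : d K b = m.-2 by rewrite /K; lia.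
have [|Ko ob] := @prP K b; first lia.
have {}ob : (d o b <= m - 3)%N by rewrite /o; lia.
rewrite -/K in xK; rewrite -/o in Ko; clearbody o K x.
have px : d p x = m.
  have := step x qp; rewrite (dC q x) xq => -[e|]; last lia.
  case: xp; apply: (pg_uniq P qx' qp (y := x));
    have := dC x x'; have := dC x q; lia.
have Kp : d K p = m.-1.
  by have := step p xK; have := step K pb; have := dle K p;
     have := dC x p; have := dC b K; have := dC p K; lia.
have qK : d q K = m.
  have := step K pq; have := dle q K; have := dC p K => ? ? [e|]; last lia.
  case: qb; apply: (pg_uniq P pq pb (y := K)); have := dC b K; lia.
split; split => //.
apply: (perspE (x := K)) => //; first by rewrite dC.
by have := step o pb; have := dC o b; have := dle p o; lia.
Qed.

(* The product of [b'] in [link p] and [x] in [link M] is [y] in [link K]; [J] is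
   the projection of both [x] and [y] to [b']. *)
Lemma legs p b b' M x K : d p b = 1%N -> d p b' = 1%N -> d b M = m ->
    d M x = 1%N -> d K p = m.-1 ->
  exists J y, [/\ d b' J = 1%N, (d J x <= m.-2)%N, d K y = 1%N &
                  (d J y <= m.-2)%N].
Proof.
move=> pb pb' bM Mx Kp.
have [|J [b'J Jx]] := @approach b' x.
  by have := step b Mx; have := step x pb; have := step x pb';
     have := dle x b; have := dC x b; have := dC M b; have := dle b' x; lia.
have [|y [Ky yJ]] := @approach K J.
  by have := step K b'J; have := step K pb'; have := dle b' K; have := dle J K;
     have := dC K J; have := dC p K; lia.
by exists J, y; split => //; rewrite dC.
Qed.

(* The degenerate case of the product [(b, x) |-> y]: over the base point [b]
   it is constant in [x1] away from [x]. *)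
Lemma fold b M x x1 K o J y : d b M = m -> d M x = 1%N -> d M x1 = 1%N ->
    x1 <> x -> d x K = 1%N -> d K b = m.-2 -> d K o = 1%N ->
    (d o b <= m - 3)%N -> d b J = 1%N -> (d J x1 <= m.-2)%N -> d K y = 1%N ->
    (d J y <= m.-2)%N -> y = o.
Proof.
move=> bM Mx Mx1 x1x xK Kb Ko ob bJ Jx1 Ky Jy.
have JM : d J M = m.-1 by exact: opp_adj bM bJ.
have KJ : d K J = m.-1.
  have := step K bJ; rewrite (dC b) (dC J) => -[e|]; last lia.
  case: x1x; apply: (pg_uniq P Mx1 Mx (y := J)); have := dC M J;
    have := dC J x1; have := step J xK; lia.
apply: (pg_uniq P Ky Ko (y := J)); have := dC J y; have := dC J o;
  have := step o bJ; have := dC b o; lia.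
Qed.

(* A neighbour of [z] opposite [Q] and [Q'] yields a projectivity from [link Q]
   to [link Q'] that maps [r] to [c]. *)
Lemma ex_joint c Q' a Q r : d Q' c = 1%N -> d Q' a = 1%N -> d Q a = 1%N ->
    d Q r = 1%N -> c <> a -> Q' <> Q -> a <> r ->
  exists z, [/\ (d z c <= m.-2)%N, (d z r <= m.-2)%N, d z Q = m.-1 &
                 d z Q' = m.-1].
Proof.
move=> Q'c Q'a Qa Qr ca QQ' ar.
have Q'Q : d Q' Q = 2.
  have := triangle Q' a Q; have := step Q Q'a; have := dC a Q => ? ? ?.
  have [e|?] := posnP (d Q' Q); first by case: QQ'; apply: (pg_eq P).
  lia.
have rQ' : d r Q' = 3.
  have := step Q' Qr; have := dC Q Q' => ? [e|]; last lia.
  case: ar; apply: (pg_uniq P Qa Qr (y := Q')); have := dC a Q'; lia.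
(* The path from [Q'] over [a] and [Q] to [r] is prolonged to a vertex [n] opposite [Q'], and [z] is
   the neighbour of [n] towards [c]. Then [z] is close to both [c] and [r], while [a] is opposite
   [z]: otherwise [a] and [c] would both be the projection of [z] to [Q']. *)
have [|n [Q'n rn]] := @extend_to Q' r (m - 3); first by rewrite dC; lia.
have {}Q'n : d Q' n = m by have := dC r Q'; lia.
have [cn nz zc] : [/\ d c n = m.-1, d n (pr n c) = 1%N &
    d (pr n c) c = m.-2].
  have := opp_adj Q'n Q'c; have := persp_adj Q'n Q'c.
  by move=> [? ? ?] ?.
set z := pr n c in nz zc *.
have zQ' : d z Q' = m.-1 by apply: opp_adj nz; rewrite dC.
have aneq : (d z a >= m)%N.
  rewrite leqNgt; apply/negP => za; apply: ca.
  apply: (pg_uniq P Q'c Q'a (y := z));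
    have := dC z c; have := dC z a; have := dC z Q'; have := step z Q'a; lia.
exists z; split => //; first lia.
- by have := triangle z n r; have := dC z n; have := dC n r; lia.
- by have := dle z Q; have := step z Qa; have := dC z Q; have := dC a z;
    have := triangle z n r; have := dC z n; have := dC n r; have := step z Qr;
    have := dC r z; lia.
Qed.

Lemma ex_common_opp z Q Q' : d z Q = m.-1 -> d z Q' = m.-1 ->
  exists y, [/\ d z y = 1%N, d Q y = m & d Q' y = m].
Proof.
move=> zQ zQ'; have [c [zc cQ cQ']] := pg_thick P z (pr z Q) (pr z Q').
by exists c; split=> //; rewrite dC (pr_far zc) //; lia.
Qed.

End polygon_theory.

Lemma infinite_inj (T : Type) (A : set T) : infinite_set A ->
  exists2 f : nat -> T, injective f & forall n, A (f n).
Proof.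
elim/Ppointed: T => T in A * => infA.
  by case: infA; rewrite [A]empty_eq0; exact: finite_set0.
have /infiniteP/pcard_leP[f] := infA.
exists f; last by move=> n; exact: funS.
by move=> a b /(@inj _ _ _ f); apply; exact/mem_set.
Qed.

Lemma ultra_finite_cst (I T : Type) (U : set_system I) (A : set T) (x : I -> T) :
  UltraFilter U -> finite_set A -> (\forall i \near U, A (x i)) ->
  exists2 c, A c & \forall i \near U, x i = c.
Proof.
move=> UU; elim/Peq: T => T in A x * => /finite_seqP[s ->].
elim: s => [|a s IH] xs; first by have [] := filter_ex xs.
have [xa|xa] := in_ultra_setVsetC [set i | x i = a] UU.
  by exists a => //=; exact: mem_head.
have [|c cs xc] := IH; last by exists c => //=; rewrite in_cons cs orbT.
by apply: filterS2 xs xa => i /=; rewrite in_cons => /orP[/eqP|].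
Qed.

(** * Limits along an ultrafilter *)

Section limits.
Variables (V : Type) (d : V -> V -> nat) (m : nat).
Hypothesis P : polygon d m.
Variables (U : set_system nat) (UU : UltraFilter U) (ulim : (nat -> V) -> V).
Hypothesis U_ne : forall k, \forall i \near U, i <> k.
Hypothesis ul_le : forall x y k, (\forall i \near U, (d (x i) (y i) <= k)%N) ->
  (d (ulim x) (ulim y) <= k)%N.
Hypothesis ul_odd : forall x y,
  \forall i \near U, odd (d (x i) (y i)) = odd (d (ulim x) (ulim y)).
Hypothesis ul_cst : forall c, ulim (fun=> c) = c.

Let m3 : (3 <= m)%N := pg_m P.
Let dC := pg_sym P.
Let dle := pg_le P.
Let step := pg_step P.
Local Notation pr := (pr d).

Lemma ultra_not (A : set nat) : ~ U A -> U (~` A).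
Proof. by have [] := in_ultra_setVsetC A UU. Qed.

Lemma ul_eq x y : (\forall i \near U, x i = y i) -> ulim x = ulim y.
Proof.
move=> e; apply: (pg_eq P); apply/eqP; rewrite -leqn0; apply: ul_le.
by apply: filterS e => i ->; rewrite (pg_refl P).
Qed.

Lemma ul_adj x y : (\forall i \near U, d (x i) (y i) = 1%N) ->
  d (ulim x) (ulim y) = 1%N.
Proof.
move=> h; have : (d (ulim x) (ulim y) <= 1)%N.
  by apply: ul_le; apply: filterS h => i ->.
have [i [-> ]] := filter_ex (filterI h (ul_odd x y)).
by case: (d (ulim x) (ulim y)) => [|[|]].
Qed.

Lemma ul_ge x y :
  \forall i \near U, (d (ulim x) (ulim y) <= d (x i) (y i))%N.
Proof.
have [e|gt0] := posnP (d (ulim x) (ulim y)).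
  by rewrite e; near=> i.
apply: contrapT => /ultra_not h.
suff : (d (ulim x) (ulim y) <= (d (ulim x) (ulim y)).-1)%N by lia.
by apply: ul_le; apply: filterS h => i /= /negP; lia.
Unshelve. all: by end_near. Qed.

(** Almost all distances are at least their limit, and the only value above [m.-1] is [m], which has
    the other parity. *)
Lemma ul_exact x y : (m.-1 <= d (ulim x) (ulim y))%N ->
  \forall i \near U, d (x i) (y i) = d (ulim x) (ulim y).
Proof.
move=> h; apply: filterS2 (ul_ge x y) (ul_odd x y) => i hi oi.
have := dle (x i) (y i); lia.
Qed.

Lemma ul_pr x y :
  (\forall i \near U, d (x i) (y i) = d (ulim x) (ulim y)) ->
  (0 < d (ulim x) (ulim y) < m)%N ->
  ulim (fun i => pr (x i) (y i)) = pr (ulim x) (ulim y).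
Proof.
move=> e /andP[h0 hm]; apply: (prE P) => //.
  by apply: ul_adj; apply: filterS e => i ei; apply: (prP P _).1; rewrite ei.
rewrite -(ltn_predK h0) ltnS; apply: ul_le; apply: filterS e => i ei.
have [|_] := @prP _ _ _ P (x i) (y i); lia.
Qed.

Lemma ul_persp x y z : d (ulim x) (ulim y) = m ->
  (\forall i \near U, d (x i) (z i) = 1%N) ->
  ulim (fun i => pr (y i) (z i)) = pr (ulim y) (ulim z).
Proof.
move=> xy xz; have := opp_adj P xy (ul_adj xz); rewrite dC => yz.
by apply: ul_pr; [apply: ul_exact; rewrite yz | lia].
Qed.

Definition link (x : V) : set V := [set y | d x y = 1%N].

Lemma persp_infinite x y : d x y = m -> infinite_set (link x) ->
  infinite_set (link y).
Proof.
move=> xy; apply: contra_not => fy.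
have yx : d y x = m by rewrite dC.
apply: (@sub_finite_set _ _ (pr x @` link y)); last exact: finite_image.
move=> z xz; exists (pr y z); last exact: (perspK P xy xz).
by have [] := persp_adj P xy xz.
Qed.

(** Any injective sequence in the panel has some limit. Two perspectivities, by way of [y], move
    this limit to a point [c] of a second panel [link Q'], and two more, by way of [w], move [c] to
    [r]. They are injective and commute with limits. *)
Lemma ul_inj_cvg Q r : infinite_set (link Q) -> d Q r = 1%N ->
  exists z : nat -> V,
    [/\ injective z, forall n, d Q (z n) = 1%N & ulim z = r].
Proof.
move=> infQ Qr; have [z zinj zQ] : exists2 z : nat -> V, injective z &
    forall n, d Q (z n) = 1%N.
  by have [f fi fQ] := infinite_inj infQ; exists f.
have QL : d Q (ulim z) = 1%N.
  by rewrite -{1}(ul_cst Q); apply: ul_adj; near=> i.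
have [e|neq] := pselect (ulim z = r); first by exists z.
have [a [Qa aL ar]] := pg_thick P Q (ulim z) r.
have [Q' [aQ' Q'Q _]] := pg_thick P a Q Q.
have [c [Q'c ca _]] := pg_thick P Q' a a.
have Q'a : d Q' a = 1%N by rewrite dC.
have [s [sc sL sQ sQ']] := ex_joint P Q'c Q'a Qa QL ca Q'Q aL.
have [t [tc tr tQ tQ']] := ex_joint P Q'c Q'a Qa Qr ca Q'Q ar.
have [y [sy Qy Q'y]] := ex_common_opp P sQ sQ'.
have [w [tw Qw Q'w]] := ex_common_opp P tQ tQ'.
have yQ' : d y Q' = m by rewrite dC.
have wQ : d w Q = m by rewrite dC.
have wt : d w t = 1%N by rewrite dC.
have ys : d y s = 1%N by rewrite dC.
pose z1 n := pr y (z n); pose z2 n := pr Q' (z1 n).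
pose z3 n := pr w (z2 n); pose z4 n := pr Q (z3 n).
have y1 n : d y (z1 n) = 1%N by have [] := persp_adj P Qy (zQ n).
have y2 n : d Q' (z2 n) = 1%N by have [] := persp_adj P yQ' (y1 n).
have y3 n : d w (z3 n) = 1%N by have [] := persp_adj P Q'w (y2 n).
have y4 n : d Q (z4 n) = 1%N by have [] := persp_adj P wQ (y3 n).
have cst A (f : nat -> V) : (forall n, d A (f n) = 1%N) ->
    \forall n \near U, d ((fun=> A) n) (f n) = 1%N by move=> h; near=> n.
have L1 : ulim z1 = s.
  have := @ul_persp (fun=> Q) (fun=> y) z; rewrite !ul_cst => -> //; last exact: cst.
  exact/esym/(perspE P Qy QL ys sL).
have L2 : ulim z2 = c.
  have := @ul_persp (fun=> y) (fun=> Q') z1; rewrite !ul_cst => -> //; last exact: cst.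
  by rewrite L1; apply/esym/(perspE P yQ' ys Q'c); rewrite dC.
have L3 : ulim z3 = t.
  have := @ul_persp (fun=> Q') (fun=> w) z2; rewrite !ul_cst => -> //; last exact: cst.
  by rewrite L2; apply/esym/(perspE P Q'w Q'c wt).
have L4 : ulim z4 = r.
  have := @ul_persp (fun=> w) (fun=> Q) z3; rewrite !ul_cst => -> //; last exact: cst.
  by rewrite L3; apply/esym/(perspE P wQ wt Qr); rewrite dC.
exists z4; split => // i j e4; apply: zinj.
have e3 : z3 i = z3 j by exact: (persp_inj P wQ) e4.
have e2 : z2 i = z2 j by exact: (persp_inj P Q'w) e3.
have e1 : z1 i = z1 j by exact: (persp_inj P yQ') e2.
exact: (persp_inj P Qy) e1.
Unshelve. all: by end_near. Qed.

(* If [link q] were finite, the projectivities from [link M] to [link K]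
   determined by points [z n -> b] of [link p] would eventually be constant off
   one point, although they are injective. *)
Lemma link_infinite p q : d p q = 1%N -> infinite_set (link p) ->
  infinite_set (link q).
Proof.
move=> pq infp finq.
have [b [pb bq _]] := pg_thick P p q q.
have [v [pv vb vq]] := pg_thick P p b q.
have [p' pp'] := ex_opp P p.
have [z [zinj pz zb]] := ul_inj_cvg infp pb.
pose M := pr p' v.
have qM : d q M = m by rewrite dC (persp_opp P pp').
have bM : d b M = m by rewrite dC (persp_opp P pp').
have [x' [qx' x'p _]] := pg_thick P q p p.
have [] := frame P pq pb (nesym bq) qM bM qx' x'p.
set x := pr M x'; set K := pr x b; set o := pr K b.
move=> [Mx xb xK Kb Kp] [qK Ko ob _].
have finK : finite_set (link K).
  by apply: contrapT => /(persp_infinite (y := q)); apply; rewrite // dC.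
have [x1 [Mx1 x1x _]] := pg_thick P M x x.
have [x2 [Mx2 x2x x21]] := pg_thick P M x x1.
have Mb : d M b = m by rewrite dC.
have zM : \forall n \near U, d (z n) M = m.
  have := @ul_exact z (fun=> M); rewrite zb ul_cst bM; apply.
  exact: leq_pred.
have zb' : \forall n \near U, z n <> b.
  have [[k zk]|nb] := pselect (exists k, z k = b); last first.
    by near=> n => e; apply: nb; exists n.
  by apply: filterS (U_ne k) => n nk zn; apply: nk; apply: zinj; rewrite zn zk.
(* By [fold] the products [y n] tend to [o]. Since [link K] is finite, almost all of them are equal
   to [o]. *)
have half w : d M w = 1%N -> w <> x -> \forall n \near U, exists J,
    [/\ d (z n) J = 1%N, (d J w <= m.-2)%N & (d J o <= m.-2)%N].
  move=> Mw wx.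
  have [J JP] := choice (fun n => legs P pb (pz n) bM Mw Kp).
  have [y yP] := choice JP.
  have zJ : d b (ulim J) = 1%N.
    by rewrite -zb; apply: ul_adj; near=> n; have [] := yP n.
  have Ky : d K (ulim y) = 1%N.
    by rewrite -{1}(ul_cst K); apply: ul_adj; near=> n; have [] := yP n.
  have yo : ulim y = o.
    apply: (fold P bM Mx Mw wx xK Kb Ko ob zJ _ Ky).
      by rewrite -{1}(ul_cst w); apply: ul_le; near=> n; have [] := yP n.
    by apply: ul_le; near=> n; have [] := yP n.
  have [|c _ yc] := ultra_finite_cst (x := y) UU finK.
    by near=> n; have [] := yP n.
  have co : c = o by rewrite -yo (@ul_eq y (fun=> c)) ?ul_cst.
  apply: filterS yc => n yn; have [zn ? ? ?] := yP n; exists (J n).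
  by split => //; rewrite -co -yn.
have [n [[[J1 [zJ1 J11 J1o]] [J2 [zJ2 J22 J2o]]] [znM znb]]] := filter_ex
  (filterI (filterI (half x1 Mx1 x1x) (half x2 Mx2 x2x)) (filterI zM zb')).
have zK : d K (z n) = m.
  have := step K (pz n); have := dC p K; have := dC (z n) K; have := dle K (z n).
  move=> ? ? ? [?|?]; last lia.
  case: znb; apply: (pg_uniq P (pz n) pb (y := K)); have := dC b K; lia.
(* Both are the projection of [o] to [link (z n)]; then [x1] and [x2] are both the projection of
   this vertex to [link M]. *)
have J12 : J1 = J2.
  rewrite (perspE P zK Ko zJ1 J1o); exact/esym/(perspE P zK Ko zJ2 J2o).
have J1M := opp_adj P znM zJ1.
case: x21; apply: (pg_uniq P Mx2 Mx1 (y := J1)); rewrite (dC _ J1) ?(dC M) ?J1M;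
  move: J12 J22 => <-; lia.
Unshelve. all: by end_near. Qed.

(** * Two standard part maps *)

Definition isometries (g : nat -> V -> V) : Prop :=
  (forall i x y, d (g i x) (g i y) = d x y) /\
  (forall i y, exists x, g i x = y).

(* Sequences of vertices play the role of points of an ultrapower, [st g] that of
   the standard part after applying the automorphisms [g]. *)
Definition st (g : nat -> V -> V) (x : nat -> V) : V := ulim (fun i => g i (x i)).

Definition Adj (x y : nat -> V) : Prop := \forall i \near U, d (x i) (y i) = 1%N.

Definition ipr (x y : nat -> V) : nat -> V := fun i => pr (x i) (y i).

Lemma AdjC x y : Adj x y -> Adj y x.
Proof. by apply: filterS => i; rewrite dC. Qed.

Lemma ultra_choice (T : Type) (R : nat -> T -> Prop) :
  (\forall i \near U, exists a, R i a) ->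
  exists a : nat -> T, \forall i \near U, R i (a i).
Proof.
move=> h; have [i0 [t0 _]] := filter_ex h.
have [|a aP] := @choice _ _ (fun i b => (exists x, R i x) -> R i b); last first.
  by exists a; apply: filterS h => j; apply: aP.
move=> i; have [[b Rb]|nR] := pselect (exists x, R i x); first by exists b.
by exists t0 => /nR.
Qed.

Section one.
Variable g : nat -> V -> V.
Hypothesis G : isometries g.
Local Notation S := (st g).
Let gd := G.1.

Lemma st_le x y k : (\forall i \near U, (d (x i) (y i) <= k)%N) ->
  (d (S x) (S y) <= k)%N.
Proof. by move=> h; apply: ul_le; apply: filterS h => i; rewrite gd. Qed.

Lemma st_eq x y : (\forall i \near U, x i = y i) -> S x = S y.
Proof. by move=> h; apply: ul_eq; apply: filterS h => i ->. Qed.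

Lemma st_adj x y : Adj x y -> d (S x) (S y) = 1%N.
Proof. by move=> h; apply: ul_adj; apply: filterS h => i; rewrite gd. Qed.

Lemma st_exact x y : (m.-1 <= d (S x) (S y))%N ->
  \forall i \near U, d (x i) (y i) = d (S x) (S y).
Proof. by move=> h; apply: filterS (ul_exact h) => i; rewrite gd. Qed.

Lemma st_pr x y : (\forall i \near U, d (x i) (y i) = d (S x) (S y)) ->
  (0 < d (S x) (S y) < m)%N -> S (ipr x y) = pr (S x) (S y) /\ Adj x (ipr x y).
Proof.
move=> e /andP[h0 hm].
have A : Adj x (ipr x y).
  by apply: filterS e => i ei; apply: (prP P _).1; rewrite ei.
split => //; apply: (prE P) => //; first exact: st_adj.
rewrite -(ltn_predK h0) ltnS; apply: st_le; apply: filterS e => i ei.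
have [|_] := @prP _ _ _ P (x i) (y i); rewrite /ipr; lia.
Qed.

Lemma st_persp x y z : d (S x) (S y) = m -> Adj x z ->
  S (ipr y z) = pr (S y) (S z) /\ Adj y (ipr y z).
Proof.
move=> xy xz; have := opp_adj P xy (st_adj xz); rewrite dC => yz.
by apply: st_pr; [apply: st_exact; rewrite yz | lia].
Qed.

Lemma st_surj v : exists x, S x = v.
Proof.
have [x xv] := choice (fun i => G.2 i v).
by exists x; rewrite /st -[RHS]ul_cst; apply: ul_eq; near=> i.
Unshelve. all: by end_near. Qed.

(** An arbitrary preimage of [v] need not be incident with [x]. So a preimage of the projection of
    [v] to an opposite vertex [o] is taken and projected back to [x]. *)
Lemma st_lift x v : d (S x) v = 1%N -> exists2 y, Adj x y & S y = v.
Proof.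
move=> xv; have [ o xo] := ex_opp P (S x).
have [ov ov' ox] := persp_adj P xo xv.
have [c cE] := st_surj (pr o v).
have [| |yE xy] := @st_pr x c; first by apply: st_exact; rewrite cE dC ox.
  by rewrite cE dC ox; lia.
by exists (ipr x c) => //; rewrite yE cE (perspK P xo xv).
Qed.

Lemma st_frame p q b M x' : Adj p q -> Adj p b -> S q <> S b ->
    d (S q) (S M) = m -> d (S b) (S M) = m -> Adj q x' -> S x' <> S p ->
  let x := ipr M x' in let K := ipr x b in let o := ipr K b in
  [/\ S x = pr (S M) (S x'), S K = pr (S x) (S b) & S o = pr (S K) (S b)] /\
  [/\ Adj M x, Adj x K & Adj K o].
Proof.
move=> pq pb qb qM bM qx' x'p x K o.
have [] := frame P (st_adj pq) (st_adj pb) qb qM bM (st_adj qx') x'p.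
have [xE Mx] := st_persp qM qx'; rewrite -xE -/x => -[_ xb _ Kb _] _.
have xbi : \forall i \near U, d (x i) (b i) = m.-1.
  by rewrite -xb; apply: st_exact; rewrite xb.
have [||KE xK] := @st_pr x b; [by rewrite xb | lia |].
rewrite -KE in Kb.
have Kbi : \forall i \near U, d (K i) (b i) = d (S K) (S b).
  rewrite Kb; apply: filterS xbi => i xbi; rewrite /K.
  by have [|_] := @prP _ _ _ P (x i) (b i); rewrite /ipr; lia.
by have [|oE Ko] := st_pr Kbi; first by rewrite Kb; lia.
Qed.

End one.

Section two.
Variables g h : nat -> V -> V.
Hypotheses (G : isometries g) (H : isometries h).
Local Notation S := (st g).
Local Notation T := (st h).

Definition opp2 x y : Prop := d (S x) (S y) = m /\ d (T x) (T y) = m.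

Lemma opp2C x y : opp2 x y -> opp2 y x.
Proof. by case=> a b; split; rewrite dC. Qed.

(* What [no_split] needs of the [eps]-closeness of [S] and [T] on [link q]; unlike
   closeness, it is invariant under perspectivities. *)
Definition ctrl (p q : nat -> V) : Prop := exists z : nat -> nat -> V,
  [/\ forall k, Adj q (z k), injective (fun k => S (z k)) &
      forall y : nat -> nat -> V,
        (\forall k \near U, Adj q (y k) /\ S (y k) = S p) ->
        ulim (fun k => T (y k)) <> ulim (fun k => T (z k))].

Lemma ul_inj_ne (w : nat -> V) v : injective w -> \forall k \near U, w k <> v.
Proof.
move=> winj; have [[k wk]|nw] := pselect (exists k, w k = v); last first.
  by near=> k => e; apply: nw; exists k.
by apply: filterS (U_ne k) => n nk wn; apply: nk; apply: winj; rewrite wk wn.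
Unshelve. all: by end_near. Qed.

(* Let [Y] be the limit of the [T (z k)], and [x'] in [link q] with [T x' = Y].
   The products [y k] of [b] with the projections of [z k] to [M] satisfy
   [S (y k) = S o] by degeneracy at [S b = S b0], while [T (y k)] tends to [T x]:
   this contradicts [ctrl]. *)
Lemma no_split p q b0 b M : Adj p q -> Adj p b0 -> Adj p b -> S b = S b0 ->
  S q <> S b0 -> T q <> T b0 -> opp2 q M -> opp2 b0 M -> ctrl p q -> T b = T b0.
Proof.
move=> pq pb0 pb Sbb Sqb Tqb [SqM TqM] [SbM TbM] [z [qz zinj zP]].
apply: contrapT => Tbb.
pose Y := ulim (fun k => T (z k)).
have TqY : d (T q) Y = 1%N.
  by rewrite -{1}(ul_cst (T q)); apply: ul_adj; near=> k; exact: st_adj.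
have [x' qx' Tx'] := st_lift H TqY.
(* The frames require [x'] to differ from [p] under both maps. [ctrl] gives this when applied to
   constant sequences: to [x'] for [S], to [p] for [T]. *)
have Sx'p : S x' <> S p.
  move=> e; apply: (zP (fun=> x')); first by near=> k.
  by rewrite ul_cst Tx'.
have Tx'p : T x' <> T p.
  move=> e; apply: (zP (fun=> p)); first by near=> k; split=> //; exact: AdjC.
  by rewrite ul_cst -e Tx'.
have := st_frame G pq pb0 Sqb SqM SbM qx' Sx'p.
have := st_frame H pq pb0 Tqb TqM TbM qx' Tx'p.
have := frame P (st_adj G pq) (st_adj G pb0) Sqb SqM SbM (st_adj G qx') Sx'p.
have := frame P (st_adj H pq) (st_adj H pb0) Tqb TqM TbM (st_adj H qx') Tx'p.
set x := ipr M x'; set K := ipr x b0; set o := ipr K b0 => /=.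
rewrite -/K -/o => TF SF.
move=> [[Tx TK To] _] [[Sx SK So] [Mx xK Ko]].
move: TF SF; rewrite -Tx -Sx -TK -SK -To -So.
move=> [[TMx Txb TxK TKb TKp] [TqK TKo Tob Tpo]].
move=> [[SMx Sxb SxK SKb SKp] [SqK SKo Sob Spo]].
pose X k := ipr M (z k).
have SX k : S (X k) = pr (S M) (S (z k)) by have [] := st_persp G SqM (qz k).
have TX k : T (X k) = pr (T M) (T (z k)) by have [] := st_persp H TqM (qz k).
have MX k : Adj M (X k) by have [] := st_persp G SqM (qz k).
have b0M : \forall i \near U, d (b0 i) (M i) = m.
  by rewrite -SbM; apply: (st_exact G); rewrite SbM leq_pred.
have Kp : \forall i \near U, d (K i) (p i) = m.-1.
  by rewrite -SKp; apply: (st_exact G); rewrite SKp.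
have Jy k : exists Jy : (nat -> V) * (nat -> V), [/\ Adj b Jy.1,
    \forall i \near U, (d (Jy.1 i) (X k i) <= m.-2)%N, Adj K Jy.2 &
    \forall i \near U, (d (Jy.1 i) (Jy.2 i) <= m.-2)%N].
  have [|Jy JyP] := @ultra_choice (V * V)%type (fun i Jy =>
    [/\ d (b i) Jy.1 = 1%N, (d Jy.1 (X k i) <= m.-2)%N, d (K i) Jy.2 = 1%N &
        (d Jy.1 Jy.2 <= m.-2)%N]).
    apply: filterS2 (filterI (filterI pb0 pb) b0M) (filterI (MX k) Kp).
    move=> i [[pb0i pbi] bMi] [MXi Kpi].
    by have [J [y ?]] := legs P pb0i pbi bMi MXi Kpi; exists (J, y).
  exists (fun i => (Jy i).1, fun i => (Jy i).2).
  by split; apply: filterS JyP => i [].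
have [{}Jy JyP] := choice Jy.
pose J k := (Jy k).1; pose y k := (Jy k).2.
have bJ k : Adj b (J k) by have [] := JyP k.
have Ky k : Adj K (y k) by have [] := JyP k.
have JX k : \forall i \near U, (d (J k i) (X k i) <= m.-2)%N by have [] := JyP k.
have JY k : \forall i \near U, (d (J k i) (y k i) <= m.-2)%N by have [] := JyP k.
have SKq : d (S K) (S q) = m by rewrite dC.
have TKq : d (T K) (T q) = m by rewrite dC.
apply: (zP (fun k => ipr q (y k))).
  have XS : injective (fun k => S (X k)).
    move=> k l; rewrite !SX => e; apply: zinj.
    by apply: (persp_inj P SqM _ _ e); exact: st_adj.
  (* The [S (X k)] are distinct, so almost all differ from [S x], the one point where the degenerate
     product is not constant. Hence [S (y k)] is [S o], which goes to [S p] in the panel of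
     [S q]. *)
  apply: filterS (ul_inj_ne (S x) XS) => k Xx.
  have [e A] := st_persp G SKq (Ky k); split => //; rewrite e Spo; congr pr.
  apply: (fold P SbM SMx _ Xx SxK SKb SKo Sob (J := S (J k))).
  - exact: st_adj.
  - by rewrite -Sbb; exact: st_adj.
  - exact: st_le.
  - exact: st_adj.
  - exact: st_le.
have Tx_lim : ulim (fun k => T (X k)) = T x.
  have := @ul_persp (fun=> T q) (fun=> T M) (fun k => T (z k)).
  rewrite !ul_cst => /(_ TqM) => e; rewrite Tx Tx' -e; last first.
    by near=> k; exact: st_adj.
  by apply: ul_eq; near=> k.
pose e := ulim (fun k => T (y k)); pose j := ulim (fun k => T (J k)).
have bj : d (T b) j = 1%N.
  by rewrite -{1}(ul_cst (T b)); apply: ul_adj; near=> k; exact: st_adj.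
have Ke : d (T K) e = 1%N.
  by rewrite -{1}(ul_cst (T K)); apply: ul_adj; near=> k; exact: st_adj.
(* On the side of [T] the product is not degenerate: [T b0] is the projection of [T K] to [T p], so
   [T b], being different, is opposite [T K]. *)
have TbK : d (T K) (T b) = m.
  have TpK := dC (T p) (T K).
  have := step (T K) (st_adj H pb); have := dC (T b) (T K).
  have := dle (T K) (T b) => ? ? [?|?]; last lia.
  case: Tbb; apply: (pg_uniq P (st_adj H pb) (st_adj H pb0) (y := T K)); try lia.
  have := dC (T b0) (T K); lia.
have TKx : d (T K) (T x) = 1%N by rewrite dC.
(* Both are the projection of [j] to [T K]. *)
have ex : e = T x.
  apply: (pg_uniq P Ke TKx (y := j)); have := opp_adj P (_ : d (T b) (T K) = m) bj;
    rewrite (dC (T b)) => /(_ TbK) jK; rewrite (dC (T K)) ?jK; last lia.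
  - rewrite dC (_ : m.-1 = m.-2.+1) ?ltnS; last lia.
    by apply: ul_le; near=> k; exact: st_le.
  - rewrite dC (_ : m.-1 = m.-2.+1) ?ltnS; last lia.
    by rewrite -Tx_lim; apply: ul_le; near=> k; exact: st_le.
have := @ul_persp (fun=> T K) (fun=> T q) (fun k => T (y k)).
rewrite !ul_cst => /(_ TKq) -e2.
transitivity (pr (T q) e).
  rewrite -e2; last by near=> k; exact: st_adj.
  by apply: ul_eq; near=> k; have [] := st_persp H TKq (Ky k).
by rewrite ex Tx (perspK P TqM) ?Tx' //.
Unshelve. all: by end_near. Qed.

Lemma ul_T_persp q w (y : nat -> nat -> V) : opp2 q w ->
  (\forall k \near U, Adj q (y k)) ->
  ulim (fun k => T (ipr w (y k))) = pr (T w) (ulim (fun k => T (y k))) /\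
  (d (T q) (ulim (fun k => T (y k))) = 1%N).
Proof.
move=> [_ qw] qy; split.
  have := @ul_persp (fun=> T q) (fun=> T w) (fun k => T (y k)).
  rewrite !ul_cst => /(_ qw) <-; last by apply: filterS qy => k; exact: st_adj.
  by apply: ul_eq; apply: filterS qy => k A; have [] := st_persp H qw A.
by rewrite -{1}(ul_cst (T q)); apply: ul_adj; apply: filterS qy => k; exact: st_adj.
Qed.

Lemma Adj_persp q w y : opp2 q w -> Adj q y -> Adj w (ipr w y).
Proof. by move=> [qw _] qy; have [] := st_persp G qw qy. Qed.

(** The perspectivities from [q] to [w] and from [w] to [q'] fix the common neighbour [p]. A
    sequence that violates [ctrl] at [q'] can thus be carried back to [q], and its condition
    [S (y k) = S p] is preserved. *)
Lemma ctrl_persp p q q' w : opp2 q w -> opp2 q' w -> Adj p q -> Adj p q' ->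
  ctrl p q -> ctrl p q'.
Proof.
move=> qw q'w pq pq' [z [qz zinj zP]].
have wq := opp2C qw; have wq' := opp2C q'w.
have [Sqw Tqw] := qw; have [Sq'w Tq'w] := q'w.
have [Swq Twq] := wq; have [Swq' Twq'] := wq'.
have wz k : Adj w (ipr w (z k)) by exact: Adj_persp (qz k).
have q'z k : Adj q' (ipr q' (ipr w (z k))) by exact: Adj_persp (wz k).
exists (fun k => ipr q' (ipr w (z k))); split => //.
  move=> k l; have [-> _] := st_persp G Swq' (wz k).
  have [-> _] := st_persp G Swq' (wz l).
  have [-> _] := st_persp G Sqw (qz k); have [-> _] := st_persp G Sqw (qz l) => e.
  have [kP _ _] := persp_adj P Sqw (st_adj G (qz k)).
  have [lP _ _] := persp_adj P Sqw (st_adj G (qz l)).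
  apply: zinj; apply: (persp_inj P Sqw); try exact: st_adj.
  exact: (persp_inj P Swq' kP lP).
move=> y yP e; apply: (zP (fun k => ipr q (ipr w (y k)))).
  apply: filterS yP => k [q'y yp].
  have wy : Adj w (ipr w (y k)) by exact: Adj_persp q'y.
  split; first exact: Adj_persp wy.
  have [-> _] := st_persp G Swq wy; have [-> _] := st_persp G Sq'w q'y.
  by rewrite yp (perspK P Sqw) //; apply: (st_adj G); exact: AdjC.
have q'y : \forall k \near U, Adj q' (y k) by apply: filterS yP => k [].
have [-> _] := @ul_T_persp w q (fun k => ipr w (y k)) wq
  (filterS (fun k => @Adj_persp q' w (y k) q'w) q'y).
have [-> _] := ul_T_persp q'w q'y; rewrite e.
have [|-> _] := @ul_T_persp w q' (fun k => ipr w (z k)) wq'; first by near=> k.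
have [|-> qT] := @ul_T_persp q w z qw; first by near=> k.
have [wT _ _] := persp_adj P Tqw qT.
by rewrite (perspK P Twq') // (perspK P Tqw).
Unshelve. all: by end_near. Qed.

Lemma opp2_ipr p p' v w : opp2 p p' -> Adj p v -> Adj p w -> S v <> S w ->
  T v <> T w -> opp2 (ipr p' v) w.
Proof.
move=> [Spp' Tpp'] pv pw Svw Tvw.
split; [have [-> _] := st_persp G Spp' pv|have [-> _] := st_persp H Tpp' pv].
- by apply: (persp_opp P Spp') => //; exact: st_adj.
- by apply: (persp_opp P Tpp') => //; exact: st_adj.
Qed.

Lemma ord3_third (i j : 'I_3) : exists k : 'I_3, k <> i /\ k <> j.
Proof.
have [k kP|none] := pickP (fun k : 'I_3 => (k != i) && (k != j)).
  by exists k; have /andP[/eqP ? /eqP ?] := kP.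
have := none (@Ordinal 3 0 isT); have := none (@Ordinal 3 1 isT).
have := none (@Ordinal 3 2 isT); rewrite -!val_eqE /=; lia.
Qed.

Definition separated (p : nat -> V) (v : 'I_3 -> nat -> V) : Prop :=
  [/\ forall i, Adj p (v i), injective (fun i => S (v i)) &
      injective (fun i => T (v i))].

(** [no_split] takes as [q] a neighbour of [p] with [ctrl] that differs from [b0] under both maps,
    and a further one is needed to construct [M]. Hence [ctrl] is first spread from [v i] to all
    three [v j]. *)
Lemma ctrl_inj p p' v i b b0 : opp2 p p' -> separated p v -> ctrl p (v i) ->
  Adj p b -> Adj p b0 -> S b = S b0 -> T b = T b0.
Proof.
move=> pp' [pv Sv Tv] ci; have cj j : ctrl p (v j).
  have [k [ki kj]] := ord3_third i j.
  apply: (@ctrl_persp p (v i) (v j) (ipr p' (v k))) => //.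
    by apply/opp2C/(opp2_ipr pp') => // e; [apply: ki|apply: ki]; [apply: Sv|apply: Tv].
  by apply/opp2C/(opp2_ipr pp') => // e; [apply: kj|apply: kj]; [apply: Sv|apply: Tv].
have key c c0 i0 : Adj p c -> Adj p c0 -> S c = S c0 ->
    (forall j, j <> i0 -> S (v j) <> S c0 /\ T (v j) <> T c0) -> T c = T c0.
  move=> pc pc0 Scc0 far.
  have [j [ji _]] := ord3_third i0 i0; have [k [ki kj]] := ord3_third i0 j.
  have [Sj Tj] := far j ji; have [Sk Tk] := far k ki.
  apply: (@no_split p (v j) c0 c (ipr p' (v k))) => //.
    by apply/opp2C/(opp2_ipr pp') => // e; [apply: kj|apply: kj]; [apply: Sv|apply: Tv].
  by apply/opp2C/(opp2_ipr pp').
(* [S] and [T] might identify [b0] with two different [v j], leaving only one to work with. If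
   [S b0] is [S (v j)], both [b] and [b0] are therefore compared with [v j], which differs from the
   other two under both maps. Otherwise only [T] can exclude an index, and at most one. *)
move=> pb pb0 Sb; have [[j Sj]|nS] := pselect (exists j, S (v j) = S b0).
  have hj c : Adj p c -> S c = S b0 -> T c = T (v j).
    move=> pc Sc; apply: (key c (v j) j) => //; first by rewrite Sj.
    by move=> k kj; split => e; apply: kj; [apply: Sv|apply: Tv].
  by rewrite (hj b) // (hj b0).
have nS' j : S (v j) <> S b0 by move=> e; apply: nS; exists j.
have [[j Tj]|nT] := pselect (exists j, T (v j) = T b0).
  apply: (key b b0 j) => // k kj; split => // e; apply: kj; apply: Tv.
  by rewrite e Tj.
apply: (key b b0 i) => // k _; split => // e; apply: nT; by exists k.
Qed.

(** The panels of the [p i] vary with [i], so [b] and [b0] are projected to a sequence [c] with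
    [g i (c i)] constant and opposite [S p]. In its finite panel a sequence is almost everywhere
    equal to its limit, and therefore [b] and [b0] agree almost everywhere. *)
Lemma finite_inj p b b0 : finite_set (link (S p)) -> Adj p b -> Adj p b0 ->
  S b = S b0 -> T b = T b0.
Proof.
move=> finp pb pb0 Sb; have [ o po] := ex_opp P (S p).
have fino : finite_set (link o).
  by apply: contrapT => /(persp_infinite (y := S p)); apply; rewrite // dC.
have [c co] := choice (fun i => G.2 i o).
have Sc : S c = o by rewrite /st -[RHS]ul_cst; apply: ul_eq; near=> i.
have pc : d (S p) (S c) = m by rewrite Sc.
have cst u : Adj c u -> \forall i \near U, g i (u i) = S u.
  move=> cu; have [|a _ ua] := ultra_finite_cst (x := fun i => g i (u i)) UU fino.
    by apply: filterS cu => i; rewrite /link /= -(co i) G.1.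
  suff -> : S u = a by [].
  by rewrite -[RHS]ul_cst; apply: ul_eq.
have [uE cu] := st_persp G pc pb; have [uE0 cu0] := st_persp G pc pb0.
apply: st_eq; have pci : \forall i \near U, d (p i) (c i) = m.
  by rewrite -pc; apply: (st_exact G); rewrite pc leq_pred.
apply: filterS2 (filterI (filterI pb pb0) pci) (filterI (cst _ cu) (cst _ cu0)).
move=> i [[pbi pb0i] pcii] [e e0]; apply: (persp_inj P pcii) => //.
apply: (pg_eq P); rewrite -(G.1 i) e e0 uE uE0 Sb; exact: (pg_refl P).
Unshelve. all: by end_near. Qed.

(** The sequence for [ctrl] is chosen so that its images under [S] tend to [S r]. By closeness the
    limit of its images under [T] is near [S r], whereas for a sequence sent to [S p] by [S] that
    limit is near [S p]. *)
Lemma near_ctrl (N : V -> V -> Prop) p q r :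
  (forall x y, (\forall k \near U, N (x k) (y k)) -> N (ulim x) (ulim y)) ->
  (forall y, Adj q y -> N (S y) (T y)) -> Adj q r -> infinite_set (link (S q)) ->
  (forall y, N (S p) y -> ~ N (S r) y) -> ctrl p q.
Proof.
move=> Ncl qN qr infq sep.
have [z [zinj qz zr]] := ul_inj_cvg infq (st_adj G qr).
have lift k : exists y, Adj q y /\ S y = z k.
  by have [y] := st_lift G (qz k); exists y.
have [w wP] := choice lift.
have wz : (fun k => S (w k)) = z by apply/funext => k; have [] := wP k.
exists w; split; [by move=> k; have [] := wP k|by rewrite wz|].
move=> y yP e; apply: (sep (ulim (fun k => T (y k)))).
  rewrite -[S p]ul_cst; apply: Ncl.
  by apply: filterS yP => k [qy <-]; exact: qN.
rewrite e -zr -wz; apply: Ncl; near=> k; apply: qN; by have [] := wP k.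
Unshelve. all: by end_near. Qed.

Lemma near_inj (N : V -> V -> Prop) p p' v i r b b0 :
  (forall x y, (\forall k \near U, N (x k) (y k)) -> N (ulim x) (ulim y)) ->
  opp2 p p' -> separated p v ->
  (forall y, Adj (v i) y -> N (S y) (T y)) -> Adj (v i) r ->
  (forall y, N (S p) y -> ~ N (S r) y) ->
  Adj p b -> Adj p b0 -> S b = S b0 -> T b = T b0.
Proof.
move=> Ncl pp' sv qN qr sep pb pb0 Sb.
have [finp|infp] := pselect (finite_set (link (S p))); first exact: (finite_inj finp).
apply: (ctrl_inj pp' sv (i := i)) => //; apply: (near_ctrl Ncl qN qr) => //.
by case: sv => pv _ _; apply: (link_infinite _ infp); exact: st_adj.
Qed.

Definition good (x : nat -> V) : Prop := forall y y', Adj x y -> Adj x y' ->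
  (S y = S y' <-> T y = T y').

Lemma good_persp x y : opp2 x y -> good x -> good y.
Proof.
move=> xy; have [Sxy Txy] := xy; have [Syx Tyx] := opp2C xy.
move=> gx z z' yz yz'.
have [Sz xz] := st_persp G Syx yz; have [Sz' xz'] := st_persp G Syx yz'.
have [Tz _] := st_persp H Tyx yz; have [Tz' _] := st_persp H Tyx yz'.
have [e1 e2] := gx _ _ xz xz'; rewrite Sz Sz' Tz Tz' in e1 e2; split => e.
- by apply: (persp_inj P Tyx (st_adj H yz) (st_adj H yz')); apply: e1; rewrite e.
- by apply: (persp_inj P Syx (st_adj G yz) (st_adj G yz')); apply: e2; rewrite e.
Qed.

(** As [p] is good, neighbours of [p] that differ under [S] differ under [T]; so [ipr p' v] is
    opposite [w] under both maps as soon as [S v <> S w]. Goodness then moves back and forth between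
    neighbours of [p] and neighbours of [p'], by way of the auxiliary [v1] and [v2]. *)
Lemma good_spread p p' q x : good p -> good q -> Adj p q -> opp2 p p' ->
  Adj p x -> good x /\ exists w, opp2 x w.
Proof.
move=> gp gq pq pp' px.
have [s1 [ps1 s1q _]] := pg_thick P (S p) (S q) (S q).
have [s2 [ps2 s2q s21]] := pg_thick P (S p) (S q) s1.
have [v1 pv1 v1E] := st_lift G ps1; have [v2 pv2 v2E] := st_lift G ps2.
subst s1 s2.
have op v w : Adj p v -> Adj p w -> S v <> S w -> opp2 (ipr p' v) w.
  by move=> pv pw vw; apply: (opp2_ipr pp') => // e; apply: vw; apply/(gp _ _ pv pw).
have gw1 : good (ipr p' v1) by apply: good_persp (gq); apply/opp2C/op.
have gw2 : good (ipr p' v2) by apply: good_persp (gq); apply/opp2C/op.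
have gv1 : good v1 by apply: good_persp gw2; apply: op.
have gw0 : good (ipr p' q).
  by apply: good_persp gv1; apply/opp2C/op => //; exact: nesym.
have [e|ne] := pselect (S x = S q).
  have xw : opp2 (ipr p' v1) x by apply: op; rewrite // e.
  by split; [exact: good_persp gw1 | exists (ipr p' v1); exact: opp2C].
have xw : opp2 (ipr p' q) x by apply: op => //; exact: nesym.
by split; [exact: good_persp gw0 | exists (ipr p' q); exact: opp2C].
Qed.

Lemma all_good p p' q : good p -> good q -> Adj p q -> opp2 p p' ->
  forall x, good x /\ exists w, opp2 x w.
Proof.
move=> gp gq pq pp'.
pose Q x := [/\ good x, exists w, opp2 x w & exists2 y, Adj x y & good y].
have Qstep x y : Q x -> Adj x y -> Q y.
  move=> [gx [w xw] [z xz gz]] xy; have [gy oy] := good_spread gx gz xz xw xy.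
  by split => //; exists x => //; exact: AdjC.
have Qp : Q p by split => //; [exists p'|exists q].
have Qn n : forall x, (\forall i \near U, d (x i) (p i) = n) -> Q x.
  elim: n => [|n IH] x xp.
    (* [x] and [p] agree only almost everywhere; two steps through [q] replace the substitution. *)
    apply: (Qstep _ _ (Qstep _ _ Qp pq)).
    by apply: filterS2 xp pq => i /(pg_eq P) ->; rewrite dC.
  apply: (Qstep (ipr x p)).
    apply: IH; apply: filterS xp => i xp.
    by have [|_] := @prP _ _ _ P (x i) (p i); rewrite /ipr; lia.
  apply: AdjC; apply: filterS xp => i xp.
  by have [|+ _] := @prP _ _ _ P (x i) (p i); rewrite /ipr; lia.
move=> x; have [|n _ xn] := @ultra_finite_cst _ _ U `I_m.+1
    (fun i => d (x i) (p i)) UU (finite_II _).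
  by near=> i; rewrite /= ltnS.
by have [gx ox _] := Qn n x xn.
Unshelve. all: by end_near. Qed.

(** Induction on the distance to a sequence [c] for which [S x] and [S c] are at distance [m.-1],
    the largest at which projections are unique. The projections of [x] and [y] towards [c] have
    equal images under [S], hence by induction under [T], so one [o] is opposite both; goodness of
    [o] compares [x] and [y] after a perspectivity to [o]. *)
Lemma good_lim x y : (forall z, good z /\ exists w, opp2 z w) ->
  S x = S y -> T x = T y.
Proof.
move=> good_all.
suff det j c : (j < m)%N -> forall x y, (\forall i \near U, d (x i) (c i) = j) ->
    (\forall i \near U, d (y i) (c i) = j) -> d (S x) (S c) = j -> S x = S y ->
    T x = T y.
  have [ o xo] := ex_opp P (S x); have [a [oa _ _]] := pg_thick P o o o.
  have [c cE] := st_surj G a => Sxy.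
  have xa : d (S x) (S c) = m.-1 by rewrite cE dC; apply: (opp_adj P _ oa); rewrite dC.
  apply: (det m.-1 c) => //; first lia.
    by rewrite -xa; apply: (st_exact G); rewrite xa.
  by rewrite -xa Sxy; apply: (st_exact G); rewrite -Sxy xa.
elim: j => [|j IH] jm {}x {}y xc yc Sxc Sxy.
  by apply: st_eq; apply: filterS2 xc yc => i /(pg_eq P) -> /(pg_eq P) ->.
have Syc : d (S y) (S c) = j.+1 by rewrite -Sxy.
have [||Sx' xx'] := @st_pr g G x c; [by rewrite Sxc | lia |].
have [||Sy' yy'] := @st_pr g G y c; [by rewrite Syc | lia |].
have xc' : \forall i \near U, d (ipr x c i) (c i) = j.
  apply: filterS xc => i xc.
  by have [|_] := @prP _ _ _ P (x i) (c i); rewrite /ipr; lia.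
have yc' : \forall i \near U, d (ipr y c i) (c i) = j.
  apply: filterS yc => i yc.
  by have [|_] := @prP _ _ _ P (y i) (c i); rewrite /ipr; lia.
have Sxy' : S (ipr x c) = S (ipr y c) by rewrite Sx' Sy' Sxy.
have Sxc' : d (S (ipr x c)) (S c) = j.
  by rewrite Sx'; have [|_] := @prP _ _ _ P (S x) (S c); lia.
have Txy' := IH (ltnW jm) _ _ xc' yc' Sxc' Sxy'.
have [_ [ o xo]] := good_all (ipr x c); have [go _] := good_all o.
have yo : opp2 (ipr y c) o by case: xo => ? ?; rewrite /opp2 -Sxy' -Txy'.
have [So To] := xo; have [So' To'] := yo.
have {}xx' := AdjC xx'; have {}yy' := AdjC yy'.
have [Su ou] := st_persp G So xx'; have [Su' ou'] := st_persp G So' yy'.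
have [Tu _] := st_persp H To xx'; have [Tu' _] := st_persp H To' yy'.
apply: (persp_inj P To); first exact: st_adj.
  by rewrite Txy'; exact: st_adj.
by rewrite -Tu -Tu'; apply/(go _ _ ou ou'); rewrite Su Su' Sxy.
Qed.

End two.

Lemma good_swap g h x : good g h x -> good h g x.
Proof. by move=> gx y y' xy xy'; split=> /(gx _ _ xy xy'). Qed.

Lemma opp2_swap g h x y : opp2 g h x y -> opp2 h g x y.
Proof. by case. Qed.

Section two_sided.
Variables g h : nat -> V -> V.
Hypotheses (G : isometries g) (H : isometries h).
Local Notation S := (st g).
Local Notation T := (st h).

Lemma near_good (N : V -> V -> Prop) p p' v i r :
  (forall x y, (\forall k \near U, N (x k) (y k)) -> N (ulim x) (ulim y)) ->
  (forall x y, N x y -> N y x) ->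
  opp2 g h p p' -> separated g h p v ->
  (forall y, Adj (v i) y -> N (S y) (T y)) -> Adj (v i) r ->
  (forall y, N (S p) y -> ~ N (S r) y) -> (forall y, N (T p) y -> ~ N (T r) y) ->
  good g h p.
Proof.
move=> Ncl Nsym pp' [pv Sv Tv] vN vr Ssep Tsep b b0 pb pb0.
split; first exact: (near_inj G H Ncl pp' (And3 pv Sv Tv) vN vr Ssep).
apply: (near_inj H G Ncl (opp2_swap pp') (And3 pv Tv Sv) _ vr Tsep pb pb0).
by move=> y vy; exact: Nsym (vN y vy).
Qed.

Lemma st_iff p p' q : good g h p -> good g h q -> Adj p q -> opp2 g h p p' ->
  forall x y, S x = S y <-> T x = T y.
Proof.
move=> gp gq pq pp' x y; have all := all_good G H gp gq pq pp'.
split; first exact: good_lim.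
apply: (good_lim H G) => z; have [gz [w zw]] := all z.
by split; [exact: good_swap|exists w; exact: opp2_swap].
Qed.

End two_sided.
End limits.

(** * From buildings to polygons *)

Fixpoint walk (V : Type) (e : V -> V -> Prop) (n : nat) (x y : V) : Prop :=
  if n is n'.+1 then exists2 z, e x z & walk e n' z y else x = y.

Section walks.
Variables (V : Type) (e : V -> V -> Prop).

Lemma walk_cat n k x y z : walk e n x y -> walk e k y z -> walk e (n + k) x z.
Proof.
elim: n x => [|n IH] x /=; first by move=> ->.
by move=> [w xw wy] yz; exists w => //; exact: IH.
Qed.

Lemma walk_rev n x y : (forall x y, e x y -> e y x) -> walk e n x y -> walk e n y x.
Proof.
move=> es; elim: n x => [|n IH] x; first by move=> /= ->.
move=> [w /es wx /IH yw]; rewrite -addn1; apply: (walk_cat yw).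
by exists x.
Qed.

Lemma walk_odd (t : V -> bool) n x y : (forall x y, e x y -> t x != t y) ->
  walk e n x y -> odd n = (t x (+) t y).
Proof.
move=> et; elim: n x => [|n IH] x /=; first by move=> ->; rewrite addbb.
by move=> [w /et xw /IH ->]; case: (t x) (t w) (t y) xw => [] [] [].
Qed.
End walks.

(** * Distances on a circuit of even length *)

Section circuits.
Local Open Scope nat_scope.

(* Distance of the positions [i, j < 2k] on a circuit of length [2k]. *)
Definition cdist (k i j : nat) : nat :=
  minn ((i - j) + (j - i)) (k.*2 - ((i - j) + (j - i))).

Definition cnext (k i j : nat) : Prop := j = i.+1 \/ (i.+1 = k.*2 /\ j = 0).

Lemma circuitP (V : Type) (k : nat) (K : complex V) : circuit k.*2 K ->
  exists a : 'I_(k.*2) -> V,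
  [/\ injective a, forall x, vertices K x <-> exists i, x = a i,
    forall i j, edge K (a i) (a j) <-> cnext k i j \/ cnext k j i &
    forall x y, edge K x y -> exists i j, x = a i /\ y = a j].
Proof.
move=> [a [ai aV aE]]; exists a; split => //.
- by move=> x; rewrite aV; split => [[i _ <-]|[i ->]]; exists i.
- have nxt (i j : 'I_k.*2) : (j = ordS i) <-> cnext k i j.
    have := ltn_ord i; have := ltn_ord j => jk ik; split.
      move/(congr1 val) => /= ->; rewrite /cnext.
      have [e|ne] := eqVneq i.+1 k.*2.
        by right; split => //; rewrite e; move: (k.*2) => n; rewrite modnn.
      by rewrite modn_small; [left|lia].
    move=> h; apply: val_inj => /=; case: h => [ji|[ei ->]].
      by rewrite modn_small ?ji //; lia.
    by rewrite ei; move: (k.*2) => n; rewrite modnn.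
  move=> i j; rewrite aE; split.
    by move=> [l [[/ai <- /ai e]|[/ai <- /ai e]]]; [left|right]; apply/nxt.
  by move=> [] /nxt ->; [exists i; left|exists j; right].
move=> x y /aE [i [[-> ->]|[-> ->]]]; first by exists i, (ordS i).
by exists (ordS i), i.
Qed.

Lemma cdist_next k i j l : i < k.*2 -> j < k.*2 -> l < k.*2 ->
  cnext k i l \/ cnext k l i -> cdist k i j <= (cdist k l j).+1.
Proof. rewrite /cdist /cnext; lia. Qed.

Lemma cdist_near k i j : 1 < k -> i < k.*2 -> j < k.*2 -> 0 < cdist k i j ->
  exists2 l, l < k.*2 & (cnext k i l \/ cnext k l i) /\ (cdist k l j).+1 = cdist k i j.
Proof.
move=> k1 ik jk; rewrite /cdist => h.
pose up := if i.+1 == k.*2 then 0 else i.+1.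
pose dn := if i == 0 then k.*2.-1 else i.-1.
have upP : up < k.*2 /\ cnext k i up by rewrite /up /cnext; case: eqP; lia.
have dnP : dn < k.*2 /\ cnext k dn i by rewrite /dn /cnext; case: eqP; lia.
have useup : (cdist k up j).+1 = cdist k i j -> exists2 l, l < k.*2 &
    (cnext k i l \/ cnext k l i) /\ (cdist k l j).+1 = cdist k i j.
  by exists up; [case: upP|split => //; left; case: upP].
have usedn : (cdist k dn j).+1 = cdist k i j -> exists2 l, l < k.*2 &
    (cnext k i l \/ cnext k l i) /\ (cdist k l j).+1 = cdist k i j.
  by exists dn; [case: dnP|split => //; right; case: dnP].
have [ij|ji] := ltnP i j; have [near|far] := leqP ((i - j) + (j - i)) k.
- by apply: useup; rewrite /cdist /up; case: eqP; lia.
- by apply: usedn; rewrite /cdist /dn; case: eqP; lia.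
- by apply: usedn; rewrite /cdist /dn; case: eqP; lia.
- by apply: useup; rewrite /cdist /up; case: eqP; lia.
Qed.

Lemma cdistP k i j : i < k.*2 -> j < k.*2 -> exists2 c, cdist k i j = c & c <= k /\
  (j = i + c \/ i = j + c \/ i + c = j + k.*2 \/ j + c = i + k.*2).
Proof. by move=> ik jk; exists (cdist k i j) => //; rewrite /cdist; lia. Qed.

Lemma cdist_forward k i i' j n : i < k.*2 -> i' < k.*2 -> j < k.*2 ->
  cnext k i i' -> cdist k i j = n.+1 -> cdist k i' j = n ->
  j = i + n.+1 \/ j + k.*2 = i + n.+1.
Proof.
move=> ik ik' jk h; have [c -> [ck cP]] := cdistP ik jk.
have [c' -> [ck' cP']] := cdistP ik' jk; move: h; rewrite /cnext; lia.
Qed.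

Lemma cdist_backward k i i' j n : i < k.*2 -> i' < k.*2 -> j < k.*2 ->
  cnext k i' i -> cdist k i j = n.+1 -> cdist k i' j = n ->
  i = j + n.+1 \/ i + k.*2 = j + n.+1.
Proof.
move=> ik ik' jk h; have [c -> [ck cP]] := cdistP ik jk.
have [c' -> [ck' cP']] := cdistP ik' jk; move: h; rewrite /cnext; lia.
Qed.

(** [i'] and [j'] lie on shortest paths from [i] to [j], but not on the same one, as they would then
    be at distance [n.-1]. Only antipodal positions are joined by two shortest paths. *)
Lemma cdist_opposite_edges k i i' j j' n : i < k.*2 -> i' < k.*2 -> j < k.*2 ->
  j' < k.*2 -> cnext k i i' \/ cnext k i' i -> cnext k j j' \/ cnext k j' j ->
  cdist k i j = n.+1 -> cdist k i' j = n -> cdist k i j' = n ->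
  cdist k i' j' = n.+1 -> 0 < n -> n.+1 = k.
Proof.
move=> ik ik' jk jk' hi hj cij ci'j cij' ci'j' n0.
have [c cE [cn cP]] := cdistP ik jk'; rewrite {}cE in cij'; subst c.
have [c cE [cn' cP']] := cdistP ik' jk'; rewrite {}cE in ci'j'; subst c.
case: hi => hi.
- have {cij ci'j} := cdist_forward ik ik' jk hi cij ci'j; move: hi hj.
  rewrite /cnext => hi hj [] e; lia.
- have {cij ci'j} := cdist_backward ik ik' jk hi cij ci'j; move: hi hj.
  rewrite /cnext => hi hj [] e; lia.
Qed.

Section one_circuit.
Variables (V : Type) (k : nat) (K : complex V) (a : 'I_(k.*2) -> V).
Hypotheses (k1 : 1 < k)
  (aE : forall i j, edge K (a i) (a j) <-> cnext k i j \/ cnext k j i)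
  (aI : forall x y, edge K x y -> exists i j, x = a i /\ y = a j).

Lemma walk_cdist_le n (i j : 'I_(k.*2)) : injective a ->
  walk (edge K) n (a i) (a j) -> cdist k i j <= n.
Proof.
move=> ai; elim: n i => [|n IH] i /=; first by move=> /ai ->; rewrite /cdist; lia.
move=> [w iw wj]; have [_ [l [_ wl]]] := aI iw; subst w.
apply: leq_trans (_ : (cdist k l j).+1 <= _); last by rewrite ltnS; exact: IH.
by apply: cdist_next => //; exact/aE.
Qed.

Lemma walk_cdist (i j : 'I_(k.*2)) : walk (edge K) (cdist k i j) (a i) (a j).
Proof.
move e : (cdist k i j) => n; elim: n i e => [|n IH] i e /=.
  congr a; apply: val_inj => /=; have := ltn_ord i; have := ltn_ord j.
  by move: e; rewrite /cdist; lia.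
have [|l lk [il lj]] := cdist_near k1 (ltn_ord i) (ltn_ord j); first by rewrite e.
exists (a (Ordinal lk)); first exact/aE.
by apply: IH => /=; rewrite e in lj; case: lj.
Qed.
End one_circuit.
End circuits.

(** * The incidence graph of a spherical building of rank 2 *)

Section building.
Local Open Scope nat_scope.
Variables (V : Type) (D : complex V) (Apt : set (complex V)).
Hypothesis hApt : apartment_system D Apt.
Hypothesis vertD : vertices D = setT.
Variable type : V -> bool.
Hypothesis typeP : forall x y, edge D x y -> type x != type y.

Lemma apartment_circuit A : Apt A ->
  exists2 k, 1 < k & circuit k.*2 A.
Proof. by have [h _ _] := hApt; move=> /h[_ []] k ? ?; exists k. Qed.

Lemma simplex_vertex (K : complex V) x : simplex K x x <-> vertices K x.
Proof. by split=> [[[]//|xx]|?]; [case: (edge_irrefl xx)|left]. Qed.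

Lemma simplex_vertices (K : complex V) x y : simplex K x y ->
  vertices K x /\ vertices K y.
Proof.
move=> [[-> ?]//|e]; split; first exact: edge_vertices e.
exact: edge_vertices (edge_sym e).
Qed.

Lemma apartment_iso A B x y : Apt A -> Apt B -> vertices A x -> vertices A y ->
  vertices B x -> vertices B y ->
  exists f, [/\ complex_iso A B f, f x = x & f y = y].
Proof.
have [_ _ h] := hApt => hA hB Ax Ay Bx By.
by have [|||| f [fi [? _ ? _]]] := h A B x x y y hA hB; try exact/simplex_vertex; exists f.
Qed.

Lemma complex_iso_walk (A B : complex V) f n x y : complex_iso A B f ->
  walk (edge A) n x y -> walk (edge B) n (f x) (f y).
Proof.
move=> [fb fe]; elim: n x => [|n IH] x /=; first by move=> ->.
move=> [z xz zy]; exists (f z); last exact: IH.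
by apply/fe => //; [exact: edge_vertices xz|exact: edge_vertices (edge_sym xz)].
Qed.

Lemma circuit_iso_le k l (A B : complex V) f : circuit k.*2 A -> circuit l.*2 B ->
  complex_iso A B f -> k <= l.
Proof.
move=> /circuitP[a [ai aV _ _]] /circuitP[b [_ bV _ _]] [[fAB fi _] _].
have Aa i : vertices A (a i) by apply/aV; exists i.
have [s sP] := choice (fun i => iffLR (bV _) (fAB _ (Aa i))).
have si : injective s.
  move=> i j e; apply: ai; apply: fi; rewrite ?inE //.
  by rewrite !sP e.
have := leq_card s si; rewrite !card_ord; lia.
Qed.

(** Two apartments need not meet, but a third one meeting both is isomorphic to each. If there is no
    apartment, the value 2 is arbitrary. *)
Lemma apartment_girth : exists2 k, 1 < k & forall A, Apt A -> circuit k.*2 A.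
Proof.
have [h1 h2 _] := hApt; have [[A hA]|noA] := pselect (exists A, Apt A); last first.
  by exists 2 => // A hA; case: noA; exists A.
have [k k1 cA] := apartment_circuit hA; exists k => // B hB.
have [l l1 cB] := apartment_circuit hB.
have vx n (K : complex V) : 1 < n -> circuit n.*2 K -> exists x, vertices K x.
  move=> n1 /circuitP[a [_ aV _ _]]; have n0 : 0 < n.*2 by lia.
  by exists (a (Ordinal n0)); apply/aV; exists (Ordinal n0).
have [[x Ax] [y By]] := (vx _ _ k1 cA, vx _ _ l1 cB).
have [||C [hC Cx Cy]] := h2 x x y y; try by apply/simplex_vertex; rewrite vertD.
have {}Cx : vertices C x by apply/simplex_vertex.
have {}Cy : vertices C y by apply/simplex_vertex.
have [n n1 cC] := apartment_circuit hC.
have [f [/(circuit_iso_le cA cC) kn _ _]] := apartment_iso hA hC Ax Ax Cx Cx.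
have [{}f [/(circuit_iso_le cC cA) nk _ _]] := apartment_iso hC hA Cx Cx Ax Ax.
have [{}f [/(circuit_iso_le cB cC) ln _ _]] := apartment_iso hB hC By By Cy Cy.
have [{}f [/(circuit_iso_le cC cB) nl _ _]] := apartment_iso hC hB Cy Cy By By.
by have -> : k = l by lia.
Qed.

Variables (k : nat).
Hypotheses (k1 : 1 < k) (hcirc : forall A, Apt A -> circuit k.*2 A).

(** A substitute for the retraction onto [A]: the rest of the walk is moved into an apartment
    through its first edge and [y], and this apartment is mapped to [A] with [x] and [y] fixed. It
    follows that apartments are isometrically embedded. *)
Lemma apartment_walk n A x y : Apt A -> vertices A x -> vertices A y ->
  walk (edge D) n x y -> exists2 l, l <= n & walk (edge A) l x y.
Proof.
have [_ h2 _] := hApt.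
elim: n A x => [|n IH] A x hA Ax Ay /=; first by exists 0.
move=> [z xz zy]; have [||B [hB Bxz By]] := h2 x z y y.
- by right.
- by apply/simplex_vertex; rewrite vertD.
have [Bx Bz] := simplex_vertices Bxz.
have {}By : vertices B y by apply/simplex_vertex.
have [l ln zyl] := IH B z hB Bz By zy.
have xyl : walk (edge B) l.+1 x y.
  exists z => //; case: Bxz => // -[xz' _].
  by case: (@edge_irrefl _ D x); rewrite {2}xz'.
have [f [fi fx fy]] := apartment_iso hB hA Bx By Ax Ay.
by exists l.+1 => //; have := complex_iso_walk fi xyl; rewrite fx fy.
Qed.

Lemma sub_walk A n x y : Apt A -> walk (edge A) n x y -> walk (edge D) n x y.
Proof.
have [h1 _ _] := hApt => hA; have [[_ AD] _] := h1 A hA.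
by elim: n x => [|n IH] x //= [z /AD xz /IH]; exists z.
Qed.

Lemma exists_dist : exists d : V -> V -> nat, forall x y,
  walk (edge D) (d x y) x y /\ (forall n, walk (edge D) n x y -> d x y <= n).
Proof.
have [_ h2 _] := hApt.
suff /choice[f fP] : forall xy : V * V, exists l, walk (edge D) l xy.1 xy.2 /\
    forall n, walk (edge D) n xy.1 xy.2 -> l <= n.
  by exists (fun x y => f (x, y)) => x y; exact: (fP (x, y)).
move=> [x y] /=; have [||A [hA Ax Ay]] := h2 x x y y.
- by apply/simplex_vertex; rewrite vertD.
- by apply/simplex_vertex; rewrite vertD.
have [a [ai aV aE aI]] := circuitP (hcirc hA).
move: Ax Ay => /simplex_vertex/aV[i ->] /simplex_vertex/aV[j ->].
have w : walk (edge D) (cdist k i j) (a i) (a j).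
  exact: sub_walk hA (walk_cdist k1 aE i j).
have ex : exists n, `[< walk (edge D) n (a i) (a j) >].
  by exists (cdist k i j); exact/asboolP.
case: (ex_minnP ex) => l /asboolP wl lmin; exists l; split => // n wn.
by apply: lmin; exact/asboolP.
Qed.

Variable d : V -> V -> nat.
Hypothesis dw : forall x y, walk (edge D) (d x y) x y.
Hypothesis dmin : forall x y n, walk (edge D) n x y -> d x y <= n.

Lemma dist_apartment A (a : 'I_(k.*2) -> V) i j : Apt A -> injective a ->
  (forall x, vertices A x <-> exists i, x = a i) ->
  (forall i j, edge A (a i) (a j) <-> cnext k i j \/ cnext k j i) ->
  (forall x y, edge A x y -> exists i j, x = a i /\ y = a j) ->
  d (a i) (a j) = cdist k i j.
Proof.
move=> hA ai aV aE aI; apply/eqP; rewrite eqn_leq; apply/andP; split.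
  by apply: dmin; exact: sub_walk hA (walk_cdist k1 aE i j).
have Aa l : vertices A (a l) by apply/aV; exists l.
have [l ld w] := apartment_walk hA (Aa i) (Aa j) (dw (a i) (a j)).
exact: leq_trans (walk_cdist_le k1 aE aI ai w) ld.
Qed.

Lemma dist_le x y : d x y <= k.
Proof.
have [_ h2 _] := hApt; have [||A [hA Ax Ay]] := h2 x x y y.
- by apply/simplex_vertex; rewrite vertD.
- by apply/simplex_vertex; rewrite vertD.
have [a [ai aV aE aI]] := circuitP (hcirc hA).
move: Ax Ay => /simplex_vertex/aV[i ->] /simplex_vertex/aV[j ->].
by rewrite (dist_apartment i j hA) // /cdist; lia.
Qed.

Lemma dist_sym x y : d x y = d y x.
Proof.
have s u v : edge D u v -> edge D v u by exact: edge_sym.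
by apply/eqP; rewrite eqn_leq !dmin //; apply: walk_rev.
Qed.

Lemma dist_edge x y : d x y = 1 <-> edge D x y.
Proof.
split=> [e|xy]; first by have := dw x y; rewrite e => -[z xz <-].
have := dmin (_ : walk (edge D) 1 x y) => /(_ (ex_intro2 _ _ y xy erefl)).
have := dw x y; case: (d x y) => [/= xy'|[|]//].
by case: (@edge_irrefl _ D x); rewrite {2}xy'.
Qed.

Lemma dist_odd x y : odd (d x y) = (type x (+) type y).
Proof. exact: walk_odd typeP (dw x y). Qed.

Lemma dist_step x y z : d x y = 1 -> d x z = (d y z).+1 \/ d y z = (d x z).+1.
Proof.
move=> xy; have xy' : edge D x y by apply/dist_edge.
have yx' := edge_sym xy'.
have := dmin (ex_intro2 _ _ y xy' (dw y z) : walk (edge D) (d y z).+1 x z).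
have := dmin (ex_intro2 _ _ x yx' (dw x z) : walk (edge D) (d x z).+1 y z).
have := dist_odd x z; have := dist_odd y z; have := typeP xy'.
by case: (type x) (type y) (type z) => [] [] [] //= _; lia.
Qed.

Lemma dist_near x y : 0 < d x y -> exists z, d x z = 1 /\ (d z y).+1 = d x y.
Proof.
move=> xy; have := dw x y; case e : (d x y) xy => [//|n] _ [z xz zy].
exists z; have xz1 : d x z = 1 by apply/dist_edge.
split => //; have := dmin zy; have := dist_step y xz1; lia.
Qed.

Lemma dist_opposite_edges x x' y y' n : edge D x x' -> edge D y y' ->
  d x y = n.+1 -> d x' y = n -> d x y' = n -> d x' y' = n.+1 -> 0 < n -> n.+1 = k.
Proof.
move=> xx' yy'; have [_ h2 _] := hApt.
have [||A [hA Ax Ay]] := h2 x x' y y'; [by right|by right|].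
have ns u v (K : complex V) : edge D u v -> simplex K u v -> edge K u v.
  move=> uv [[uv' _]|//]; by case: (@edge_irrefl _ D u); rewrite {2}uv'.
have {}Ax := ns _ _ _ xx' Ax; have {}Ay := ns _ _ _ yy' Ay.
have [a [ai aV aE aI]] := circuitP (hcirc hA).
have [i [i' [xi xi']]] := aI _ _ Ax; have [j [j' [yj yj']]] := aI _ _ Ay.
rewrite {}xi {}xi' {}yj {}yj' in Ax Ay *.
have dA := fun i j => dist_apartment i j hA ai aV aE aI; rewrite !{}dA.
by apply: cdist_opposite_edges => //; exact/aE.
Qed.

(** Induction along a shortest path from [y] to [z], with first vertex [y1]. If [z'] is also close
    to [y1], then [y1] replaces [y]. Otherwise the edges from [x] to [z'] and from [y] to [y1] lie
    in a common apartment in the position of [dist_opposite_edges], so [d x y] would be [k]. *)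
Lemma dist_uniq x y z z' : d x z = 1 -> d x z' = 1 -> d z y < d x y ->
  d z' y < d x y -> d x y < k -> z = z'.
Proof.
have d0 u v : d u v = 0 -> u = v by move=> e; have := dw u v; rewrite e.
move e : (d x y) => n; elim: n y e => [|n IH] y xy xz xz' zy zy' nk; first by [].
have {}zy : d z y = n by have := dist_step y xz; lia.
have {}zy' : d z' y = n by have := dist_step y xz'; lia.
have [n0|n0] := posnP n.
  by rewrite n0 in zy zy'; rewrite (d0 _ _ zy) (d0 _ _ zy').
have [|y1 [yy1 y1z]] := @dist_near y z; first by rewrite dist_sym zy.
have y1x : d y1 x = n.
  have := dist_step x yy1; have := dist_step y1 xz; have := dist_sym z y1;
  have := dist_sym x y1; have := dist_sym x y; have := dist_sym y z; lia.
have [e1|ne] := eqVneq (d z' y1) n.-1.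
  apply: (IH y1) => //; have := dist_sym z y1; have := dist_sym x y1;
  have := dist_sym y z; lia.
have := @dist_opposite_edges x z' y y1 n.
rewrite xy zy' (dist_sym x y1) y1x => h.
suff : n.+1 = k by lia.
apply: h => //; first exact/dist_edge.
  exact/dist_edge.
have := dist_step z' yy1; have := dist_sym z' y; have := dist_sym z' y1; lia.
Qed.

End building.

(** * Galleries of chambers and walks of vertices *)

Section chambers_galleries.
Local Open Scope nat_scope.
Variables (V : Type) (D : typed_complex V).

Lemma in_chamberP x (X : Cham D) : in_chamber x X -> exists u,
  [/\ edge D x u, in_chamber u X &
      set_val X = if vtype D x then (u, x) else (x, u)].
Proof.
have : Cham D (set_val X) by exact: set_valP.
rewrite /in_chamber; move: (set_val X) => -[a b] [/= ab ta tb].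
move=> [->|->]; first by exists b; rewrite ta; split => //; right.
by exists a; rewrite tb; split => //; [exact: edge_sym|left].
Qed.

Lemma ex_chamber x y : edge D x y -> exists X : Cham D,
  in_chamber x X /\ in_chamber y X.
Proof.
move=> xy; have := vtypeP xy; case tx : (vtype D x); case ty : (vtype D y) => // _.
  have h : (y, x) \in Cham D by apply/mem_set; split => //; exact: edge_sym.
  by exists (exist _ (y, x) h); split; [right|left].
have h : (x, y) \in Cham D by apply/mem_set.
by exists (exist _ (x, y) h); split; [left|right].
Qed.

Lemma galleryS n (X Y : Cham D) :
  gallery n.+1 X Y <-> exists2 Z, Defs.adjacent X Z & gallery n Z Y.
Proof.
split=> [[g [g0 gn gS]]|[Z XZ [g [g0 gn gS]]]].
  exists (g 1); first by rewrite -g0; exact: gS.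
  by exists (fun i => g i.+1); split => // i ik; exact: gS.
exists (fun i => if i is j.+1 then g j else X); split => // -[|i] ik.
  by rewrite g0.
exact: gS.
Qed.

Lemma walk_gallery n x y (X Y : Cham D) : walk (edge D) n x y ->
  in_chamber x X -> in_chamber y Y -> gallery n.+1 X Y.
Proof.
elim: n x X => [|n IH] x X /=.
  move=> <- xX xY; apply/galleryS; exists Y; first by exists x.
  by exists (fun=> Y).
move=> [z xz zy] xX yY; have [Z [xZ zZ]] := ex_chamber xz.
by apply/galleryS; exists Z; [exists x|exact: IH zy zZ yY].
Qed.

Variable d : V -> V -> nat.
Hypothesis dw : forall x y, walk (edge D) (d x y) x y.
Hypothesis dmin : forall x y n, walk (edge D) n x y -> d x y <= n.

Lemma chamber_dist x y (X : Cham D) : in_chamber x X -> in_chamber y X ->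
  x = y \/ edge D x y.
Proof.
have : Cham D (set_val X) by exact: set_valP.
rewrite /in_chamber; move: (set_val X) => -[a b] [/= ab _ _].
by move=> [->|->] [->|->]; try (by left); right => //; exact: edge_sym.
Qed.

Lemma gallery_dist n (X Y : Cham D) : gallery n.+1 X Y ->
  exists x y, [/\ in_chamber x X, in_chamber y Y & d x y <= n].
Proof.
elim: n X => [|n IH] X /galleryS[Z [v [vX vZ]]].
  move=> [g [g0 g0' _]]; have ZY : Z = Y by rewrite -g0 g0'.
  by exists v, v; split; rewrite -?ZY //; exact: (@dmin v v 0 erefl).
move=> /IH[z [y [zZ yY zy]]]; exists v, y; split => //.
have [->|vz] := chamber_dist vZ zZ; first exact: leqW.
by apply: leq_trans (_ : (d z y).+1 <= _) => //; apply: dmin; exists z.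
Qed.
End chambers_galleries.

(** The diameter [m] is measured by galleries, the half-length [k] of the apartments by walks. A
    walk with [n] edges gives a gallery of length [n.+1], and a gallery of that length gives a walk
    with at most [n] edges; so [m] and [k] have to be shown equal. *)
Lemma mgon_polygon (V : Type) (D : typed_complex V) (m : nat) :
  mgon D m -> thick D -> (3 <= m)%N ->
  exists d : V -> V -> nat, [/\ polygon d m, forall x y, d x y = 1%N <-> edge D x y &
    forall (C C' : Cham D) p q, opposite m C C' -> in_chamber p C ->
      in_chamber q C -> d p q = 1%N -> exists p' q',
        [/\ in_chamber p' C', in_chamber q' C', d p' q' = 1%N, d p p' = m &
            d q q' = m]].
Proof.
move=> [[Apt hApt] [diam [X0 [Y0 XY0]]]] hthick m3.
have hv := verticesT D; have tP := @vtypeP _ D.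
have [k k1 hcirc] := apartment_girth hApt hv.
have [d dP] := exists_dist hApt hv k1 hcirc.
have dw x y : walk (edge D) (d x y) x y by have [] := dP x y.
have dmin x y n : walk (edge D) n x y -> (d x y <= n)%N by have [_] := dP x y; apply.
have d1 := dist_edge dw dmin.
have step := dist_step tP k1 dw dmin.
have dle := dist_le hApt hv k1 hcirc dw dmin.
have dsym := dist_sym dw dmin.
have dthick x a b : exists c, [/\ d x c = 1%N, c <> a & c <> b].
  have [X [Y [Z [[XY YZ XZ] [xX xY xZ]]]]] := hthick x.
  have [u [xu _ uE]] := in_chamberP xX; have [v [xv _ vE]] := in_chamberP xY.
  have [w [xw _ wE]] := in_chamberP xZ.
  have uv : u <> v by move=> e; apply: XY; apply: val_inj; rewrite -!set_valE uE vE e.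
  have vw : v <> w by move=> e; apply: YZ; apply: val_inj; rewrite -!set_valE wE vE e.
  have uw : u <> w by move=> e; apply: XZ; apply: val_inj; rewrite -!set_valE uE wE e.
  have [[ua ub]|nu] := pselect (u <> a /\ u <> b).
    by exists u; split => //; apply/d1.
  have [[va vb]|nv] := pselect (v <> a /\ v <> b).
    by exists v; split => //; apply/d1.
  exists w; split; first exact/d1.
    move=> e; apply: nu; split; [by rewrite -e|move=> ub; apply: nv].
    by split; [rewrite -e|move=> vb; apply: uv; rewrite ub vb].
  move=> e; apply: nu; split; [move=> ua; apply: nv|by rewrite -e].
  by split; [move=> va; apply: uv; rewrite ua va|rewrite -e].
have geom : (3 <= k)%N -> polygon d k.
  move=> k3; split => //.
  - by move=> x y e; have := dw x y; rewrite e.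
  - by move=> x; apply/eqP; rewrite -leqn0; exact: dmin.
  - exact: (dist_near tP k1 dw dmin).
  - exact: (dist_uniq hApt hv tP k1 hcirc dw dmin).
have galk (X Y : Cham D) x : in_chamber x X -> exists y n,
    [/\ in_chamber y Y, (n <= k.-1)%N & walk (edge D) n x y].
  move=> xX.
  have Y1 : in_chamber (set_val Y).1 Y by left.
  have [u [yu uY _]] := in_chamberP Y1; have /d1 yu1 := yu.
  have := step _ _ x yu1; rewrite !(dsym _ x).
  have [le1|gt1] := leqP (d x (set_val Y).1) k.-1.
    by exists (set_val Y).1, (d x (set_val Y).1).
  exists u, (d x u); split => //; have := dle x (set_val Y).1; have := dle x u; lia.
have mk : (m <= k)%N.
  have [y [n [yY nk w]]] := galk X0 Y0 (set_val X0).1 (or_introl erefl).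
  have gal := walk_gallery w (or_introl erefl) yY.
  have [_ nogal] := XY0; rewrite leqNgt; apply/negP => km.
  by apply: (nogal n.+1) gal; lia.
have P := geom (leq_trans m3 mk).
have km : (k <= m)%N.
  have [y xy] := ex_opp P (set_val X0).1; set x := (set_val X0).1 in xy.
  have [x1 [xx1 x1X X0E]] := in_chamberP (or_introl erefl : in_chamber x X0).
  have x1y := opp_adj P xy (iffRL (d1 _ _) xx1).
  (* Avoiding the projection of [x1] makes [y1] opposite [x1]. Then all distances between the two
     edges are at least [k.-1], and their chambers are at gallery distance at least [k]. *)
  have [y1 [yy1 y1x _]] := dthick y (pr d y x1) y.
  have x1y1 : d x1 y1 = k.
    by rewrite dsym (pr_far P yy1 y1x) // dsym x1y; lia.
  have xy1 : d x y1 = k.-1 by rewrite dsym; apply: (opp_adj P _ yy1); rewrite dsym.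
  have [Y [yY y1Y]] := ex_chamber (iffLR (d1 _ _) yy1).
  have inX0 u : in_chamber u X0 -> u = x \/ u = x1.
    by rewrite /in_chamber X0E; case: ifP => _ /= [] ->; tauto.
  have inY u : in_chamber u Y -> u = y \/ u = y1.
    have [v [yv vY YE]] := in_chamberP yY.
    have : y1 = y \/ y1 = v.
      by move: y1Y; rewrite /in_chamber YE; case: ifP => _ /=; tauto.
    move=> [e|e]; first by move: yy1; rewrite e (pg_refl P).
    by rewrite /in_chamber YE -e; case: ifP => _ /= [] ->; tauto.
  have [n nm [gal _]] := diam X0 Y; apply: leq_trans nm.
  case: n gal => [|n] gal.
    have [g [g0 g0' _]] := gal.
    have xY : in_chamber x Y by rewrite -g0' g0; left.
    move: (chamber_dist xY yY) => [e|/d1]; last by rewrite xy; lia.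
    by move: xy; rewrite e (pg_refl P); lia.
  have [u [v [/inX0 uX /inY vY uv]]] := gallery_dist dw dmin gal.
  by move: uX vY uv => [->|->] [->|->]; rewrite ?xy ?x1y ?xy1 ?x1y1; lia.
have {km mk} e : k = m by apply/eqP; rewrite eqn_leq km.
subst k; exists d; split => // C C' p q [_ nogal] pC qC pq.
(* Once these distances are at least [m.-1], parity shows that a vertex of [C] is opposite exactly
   one of the two vertices of [C']. *)
have far u v : in_chamber u C -> in_chamber v C' -> (m.-1 <= d u v)%N.
  move=> uC vC'; rewrite leqNgt; apply/negP => lt.
  by apply: (nogal (d u v).+1); [lia|exact: walk_gallery (dw u v) uC vC'].
have C'1 : in_chamber (set_val C').1 C' by left.
have [v [/d1 uv vC' _]] := in_chamberP C'1; set u := (set_val C').1 in C'1 uv *.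
have := far _ _ pC C'1; have := far _ _ pC vC'; have := far _ _ qC C'1.
have := far _ _ qC vC'; have := step _ _ p uv; have := step _ _ q uv.
have := step _ _ u pq; have := step _ _ v pq.
have := dle p u; have := dle q u; have := dle p v; have := dle q v.
have := dsym u p; have := dsym u q; have := dsym v p; have := dsym v q.
have [pu|pu] := eqVneq (d p u) m => *.
  exists u, v; split => //; lia.
exists v, u; split => //; rewrite 1?dsym //; lia.
Qed.

Local Open Scope ring_scope.

(** * Compact polygons *)

Lemma ultra_cvg (I : Type) (T : topologicalType) (F : set_system I) (K : set T)
    (x : I -> T) : UltraFilter F -> compact K -> (\forall i \near F, K (x i)) ->
  exists2 l, K l & x @ F --> l.
Proof.
move=> FU cK Kx; have [l [Kl cl]] := cK (x @ F) _ Kx; exists l => // A nA.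
have [//|nAx] := in_ultra_setVsetC (x @^-1` A) FU.
by have [y [/=]] := cl (~` A) A nAx nA.
Qed.

(** * Convergence with respect to a metric inducing the topology *)

Section metric.
Variables (R : realType) (T : topologicalType) (rho : T -> T -> R).
Hypothesis hrho : metric_inducing_topology rho.
Let eq0 := let: And4 h _ _ _ := hrho in h.
Let rC := let: And4 _ h _ _ := hrho in h.
Let rT := let: And4 _ _ h _ := hrho in h.
Let nbhsE := let: And4 _ _ _ h := hrho in h.

Lemma metric_ge0 x y : 0 <= rho x y.
Proof. by have := rT x y x; rewrite (eq0 x x).2 // (rC y); lra. Qed.

Lemma metric_refl x : rho x x = 0.
Proof. exact/eq0. Qed.

Lemma metric_gt0 x y : x <> y -> 0 < rho x y.
Proof.
by move=> xy; rewrite lt_neqAle metric_ge0 andbT eq_sym; apply/eqP => /eq0.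
Qed.

Lemma metric_cvg (I : Type) (F : set_system I) (x : I -> T) (l : T) : Filter F ->
  x @ F --> l <-> forall e, 0 < e -> \forall i \near F, rho l (x i) < e.
Proof.
move=> FF; split=> [xl e e0|h A].
  by apply: (xl [set y | rho l y < e]); apply/nbhsE; exists e.
by move=> /nbhsE[e e0 eA]; apply: filterS (h e e0) => i; exact: eA.
Qed.

Lemma metric_cvg_le (I : Type) (F : set_system I) (x y : I -> T) (a b : T) e :
  ProperFilter F -> x @ F --> a -> y @ F --> b ->
  (\forall i \near F, rho (x i) (y i) <= e) -> rho a b <= e.
Proof.
move=> FF /metric_cvg xa /metric_cvg yb xy; apply/ler_addgt0Pr => d d0.
have d2 : 0 < d / 2 by rewrite divr_gt0.
have [i [[h1 h2] h3]] := filter_ex (filterI (filterI (xa _ d2) (yb _ d2)) xy).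
have := rT a (x i) b; have := rT (x i) (y i) b; have := rC (y i) b.
by move: h1 h2 h3 => /=; lra.
Qed.

Lemma metric_cvg_unique (I : Type) (F : set_system I) (x y : I -> T) (a b : T) :
  ProperFilter F -> x @ F --> a -> y @ F --> b ->
  (forall e, 0 < e -> \forall i \near F, rho (x i) (y i) <= e) -> a = b.
Proof.
move=> FF xa yb xy; apply/eq0/eqP; rewrite eq_le metric_ge0 andbT.
apply/ler_addgt0Pr => e e0; rewrite add0r.
by apply: metric_cvg_le xa yb _; exact: xy.
Qed.

Lemma metric_cvg_near (I : Type) (F : set_system I) (x y : I -> T) (a : T) :
  Filter F -> x @ F --> a -> y @ F --> a ->
  forall e, 0 < e -> \forall i \near F, rho (x i) (y i) < e.
Proof.
move=> FF /metric_cvg xa /metric_cvg ya e e0.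
have e2 : 0 < e / 2 by rewrite divr_gt0.
apply: filterS2 (xa _ e2) (ya _ e2) => i /= ? ?.
have := rT (x i) a (y i); have := rC (x i) a; lra.
Qed.

Lemma metric_continuous (S : topologicalType) (sigma : S -> S -> R) (f : T -> S) :
  metric_inducing_topology sigma ->
  (forall e, 0 < e -> exists2 d, 0 < d & forall x y, rho x y < d ->
     sigma (f x) (f y) <= e) -> continuous f.
Proof.
move=> [_ _ _ sE] h x A /sE[e e0 eA]; have e2 : 0 < e / 2 by rewrite divr_gt0.
have [d d0 dP] := h _ e2; apply/nbhsE; exists d => // y xy; apply: eA => /=.
by have := dP _ _ xy; lra.
Qed.
End metric.

Lemma initial_cvg (I : Type) (S : choiceType) (T : topologicalType) (f : S -> T)
    (F : set_system I) (X : I -> initial_topology f) (L : initial_topology f) :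
  Filter F -> (fun i => f (X i)) @ F --> f L -> X @ F --> L.
Proof.
move=> FF h B [_ [[W oW <-] WL] WB].
have nW : nbhs (f L) W by exact: open_nbhs_nbhs.
have FW : F [set i | W (f (X i))] := h W nW.
by apply: filterS FW => i; exact: WB.
Qed.

Lemma Cham_cvg (I : Type) (V : topologicalType) (D : typed_complex V)
    (F : set_system I) {FF : Filter F} (X : I -> Cham D) (L : Cham D) :
  X @ F --> L <-> (fun i => (set_val (X i)).1) @ F --> (set_val L).1 /\
                  (fun i => (set_val (X i)).2) @ F --> (set_val L).2.
Proof.
split=> [XL|[X1 X2]].
  have XL' := cvg_comp _ _ XL (@initial_continuous _ _ (@set_val _ (Cham D)) L).
  by split; apply: cvg_comp XL' _; [exact: cvg_fst|exact: cvg_snd].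
apply: initial_cvg; rewrite (surjective_pairing (set_val L)).
rewrite (_ : (fun i => _) = fun i => ((set_val (X i)).1, (set_val (X i)).2)).
  exact: cvg_pair.
by apply/funext => i; rewrite -surjective_pairing.
Qed.

Section compact_polygon.
Variables (R : realType) (V : topologicalType) (D : typed_complex V) (m : nat).
Variables (d : V -> V -> nat) (rho : V -> V -> R).
Hypotheses (P : polygon d m) (dE : forall x y, d x y = 1%N <-> edge D x y).
Hypotheses (cptV : compact [set: V]) (hrho : metric_inducing_topology rho).
Hypothesis closedC : closed (Cham D).

Let rC : forall x y, rho x y = rho y x.
Proof. by case: hrho. Qed.
Let rT : forall x y z, rho x z <= rho x y + rho y z.
Proof. by case: hrho. Qed.

Lemma dist_vtype x y : odd (d x y) = (vtype D x (+) vtype D y).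
Proof.
move e : (d x y) => n; elim: n x e => [|n IH] x e.
  by rewrite (pg_eq P e) addbb.
have [|z [/dE xz zy]] := @pg_near _ _ _ P x y; first by rewrite e.
rewrite /= (IH z); last lia.
by have := vtypeP xz; case: (vtype D x) (vtype D z) => [] [] //; case: (vtype D y).
Qed.

Lemma Cham_edge x y : edge D x y -> Cham D (x, y) \/ Cham D (y, x).
Proof.
move=> xy; have yx := edge_sym xy; have := vtypeP xy.
by case tx : (vtype D x); case ty : (vtype D y) => // _; [right|left].
Qed.

Lemma iso_dist (f : V -> V) x y : complex_iso D D f -> d (f x) (f y) = d x y.
Proof.
have all z : vertices D z by rewrite verticesT.
move=> [[_ fi fs] fE].
have fE' a b : d (f a) (f b) = 1%N <-> d a b = 1%N.
  have [ab ba] := fE a b (all a) (all b).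
  by split=> /dE h; apply/dE; [exact: ba|exact: ab].
apply/eqP; rewrite eqn_leq; apply/andP; split.
  move e : (d x y) => n; elim: n x e => [|n IH] x e.
    by rewrite (pg_eq P e) (pg_refl P).
  have [|z [xz zy]] := @pg_near _ _ _ P x y; first by rewrite e.
  have /fE' xz' := xz; have := pg_step P (f y) xz'.
  by have := IH z ltac:(lia); lia.
move e : (d (f x) (f y)) => n; elim: n x e => [|n IH] x e.
  suff -> : x = y by rewrite (pg_refl P).
  by apply: fi (pg_eq P e); rewrite ?inE.
have [|z [xz zy]] := @pg_near _ _ _ P (f x) (f y); first by rewrite e.
have [w _ wz] := fs z (all z); subst z; have {}xz := iffLR (fE' _ _) xz.
have := pg_step P y xz; have := IH w ltac:(lia); lia.
Qed.

(** * Incidence, types and distances in the limit *)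

Section limits.
Variables (I : Type) (F : set_system I) (FU : UltraFilter F).

Lemma lim_Cham (x y : I -> V) (a b : V) : x @ F --> a -> y @ F --> b ->
  (\forall i \near F, Cham D (x i, y i)) -> Cham D (a, b).
Proof.
move=> xa yb xy; apply: (closed_cvg (fun p => Cham D p) closedC xy).
exact: cvg_pair.
Qed.

Lemma lim_edge (x y : I -> V) (a b : V) : x @ F --> a -> y @ F --> b ->
  (\forall i \near F, edge D (x i) (y i)) -> edge D a b.
Proof.
move=> xa yb xy; have [h|h] := in_ultra_setVsetC [set i | Cham D (x i, y i)] FU.
  by have [] := lim_Cham xa yb h.
have [ba _ _] : Cham D (b, a).
  apply: (lim_Cham yb xa); apply: filterS2 xy h => i /Cham_edge[] //.
exact: edge_sym.
Qed.

Lemma lim_ex (x : I -> V) : exists l : V, x @ F --> l.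
Proof. by have [|l _] := ultra_cvg (x := x) FU cptV; [near=> i|exists l].
Unshelve. all: by end_near. Qed.

(** Types are locally constant because [Cham D] is closed: with a neighbour chosen for each [x i],
    the ultrafilter decides the order in which the pairs are chambers, and the limit pair is a
    chamber in the same order. *)
Lemma lim_vtype (x : I -> V) (a : V) : x @ F --> a ->
  \forall i \near F, vtype D (x i) = vtype D a.
Proof.
move=> xa; have nb i : exists y, edge D (x i) y.
  by have [y [/dE ? _ _]] := pg_thick P (x i) (x i) (x i); exists y.
have [y xy] := choice nb; have [b yb] := lim_ex y.
have [h|h] := in_ultra_setVsetC [set i | Cham D (x i, y i)] FU.
  have [_ /= -> _] := lim_Cham xa yb h.
  by apply: filterS h => i [].
have h' : \forall i \near F, Cham D (y i, x i).
  by apply: filterS h => i /= nc; case: (Cham_edge (xy i)).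
have [_ _ /= ->] := lim_Cham yb xa h'.
by apply: filterS h' => i [].
Qed.

(** Shortest paths converge vertex by vertex, by compactness, and edges tend to edges. The next
    vertex [z i] may equal [x i], which accommodates paths shorter than the bound. *)
Lemma lim_dist (x y : I -> V) (a b : V) k : x @ F --> a -> y @ F --> b ->
  (\forall i \near F, (d (x i) (y i) <= k)%N) -> (d a b <= k)%N.
Proof.
move=> + yb; elim: k x a => [|k IH] x a xa xy.
  rewrite (metric_cvg_unique hrho _ xa yb) ?(pg_refl P) // => e e0.
  apply: filterS xy => i; rewrite leqn0 => /eqP/(pg_eq P) ->.
  by have [h _ _ _] := hrho; rewrite (h _ _).2 // ltW.
have nb i : exists z, (d (x i) (y i) <= k.+1)%N ->
    (x i = z \/ edge D (x i) z) /\ (d z (y i) <= k)%N.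
  have [h|h] := leqP (d (x i) (y i)) k; first by exists (x i) => _; split; [left|].
  have [|z [/dE xz zy]] := @pg_near _ _ _ P (x i) (y i); first lia.
  by exists z => ?; split; [right|lia].
have [z zP] := choice nb; have [c zc] := lim_ex z.
have {}IH : (d c b <= k)%N by apply: (IH z) => //; apply: filterS xy => i /zP[].
have [h|h] := in_ultra_setVsetC [set i | x i = z i] FU.
  suff -> : a = c by exact: leqW.
  apply: (metric_cvg_unique hrho _ xa zc) => e e0; apply: filterS h => i ->.
  by have [h0 _ _ _] := hrho; rewrite (h0 _ _).2 // ltW.
have /dE ac : edge D a c.
  by apply: (lim_edge xa zc); apply: filterS2 xy h => i /zP[[]].
by have := pg_step P b ac; lia.
Qed.

Lemma lim_dist_odd (x y : I -> V) (a b : V) : x @ F --> a -> y @ F --> b ->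
  \forall i \near F, odd (d (x i) (y i)) = odd (d a b).
Proof.
move=> xa yb; apply: filterS2 (lim_vtype xa) (lim_vtype yb) => i ea eb.
by rewrite !dist_vtype ea eb.
Qed.
End limits.

Lemma ultra_lim (U : set_system nat) : UltraFilter U ->
  exists2 ulim : (nat -> V) -> V, forall x, x @ U --> ulim x &
    [/\ forall x y k, (\forall i \near U, (d (x i) (y i) <= k)%N) ->
          (d (ulim x) (ulim y) <= k)%N,
        forall x y, \forall i \near U,
          odd (d (x i) (y i)) = odd (d (ulim x) (ulim y)) &
        forall c, ulim (fun=> c) = c].
Proof.
move=> UU; have [ulim uP] := choice (fun x => lim_ex UU x).
exists ulim => //; split.
- by move=> x y k; exact: lim_dist (uP x) (uP y).
- by move=> x y; exact: lim_dist_odd (uP x) (uP y).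
- move=> c; apply: (metric_cvg_unique hrho _ (uP _) (cvg_cst c)) => e e0.
  near=> i; have [h _ _ _] := hrho; rewrite (h _ _).2 // ltW //.
Unshelve. all: by end_near. Qed.

Lemma triple p q : d p q = 1%N -> exists v : 'I_3 -> V,
  [/\ v ord0 = q, forall i, d p (v i) = 1%N & injective v].
Proof.
move=> pq; have [a [pa aq _]] := pg_thick P p q q.
have [b [pb bq ba]] := pg_thick P p q a.
exists (fun i : 'I_3 => if val i == 0%N then q else if val i == 1%N then a else b).
split => // [i|i j]; first by case: ifP => // _; case: ifP.
case: i j => [[|[|[|//]]] hi] [[|[|[|//]]] hj] /= e; apply: val_inj => //=;
  by [case: aq|case: bq|case: ba|case: ba|case: bq|case: aq].
Qed.

(** * Equicontinuity of automorphisms that are close to the identity near a chamber *)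

Section nonprincipal.
Variables (U : set_system nat) (UU : UltraFilter U).
Hypothesis U_inf : \oo `<=` U.

Let U_ne k : \forall i \near U, i <> k.
Proof. by apply: U_inf; exists k.+1 => // i /=; lia. Qed.

Lemma near_nonprincipal (fs : nat -> V -> V) (ulim : (nat -> V) -> V)
    p q p' (v w : 'I_3 -> V) (e : R) :
  (forall n, complex_iso D D (fs n)) -> (forall x, x @ U --> ulim x) ->
  (forall c, ulim (fun=> c) = c) ->
  d p q = 1%N -> v ord0 = q -> (forall i, d p (v i) = 1%N) ->
  (forall i j, i <> j -> 4 * e < rho (v i) (v j)) ->
  w ord0 = p -> (forall i, d q (w i) = 1%N) ->
  (forall i j, i <> j -> 4 * e < rho (w i) (w j)) ->
  (forall n x, d p x = 1%N -> rho x (fs n x) <= e) ->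
  (forall n x, d q x = 1%N -> rho x (fs n x) <= e) ->
  (forall n, rho p' (fs n p') <= e) ->
  (forall a b, rho p a <= e -> rho p' b <= e -> d a b = m) ->
  opp2 d m ulim (fun=> id) fs (fun=> p) (fun=> p') /\
  good d U ulim (fun=> id) fs (fun=> p).
Proof.
move=> fiso uP ul_cst pq v0 pv vsep w0 qw wsep pe qe p'e popp.
have e0 : 0 <= e.
  by apply: le_trans (p'e 0%N); exact: metric_ge0 hrho _ _.
have ul_le x y k : (\forall i \near U, (d (x i) (y i) <= k)%N) ->
    (d (ulim x) (ulim y) <= k)%N by exact: lim_dist (uP x) (uP y).
have ul_odd x y : \forall i \near U,
    odd (d (x i) (y i)) = odd (d (ulim x) (ulim y)).
  exact: lim_dist_odd (uP x) (uP y).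
have G : isometries d (fun _ : nat => @id V) by split => // i y; exists y.
have H : isometries d fs.
  split=> [n x y|n y]; first exact: iso_dist.
  have [[_ _ fsurj] _] := fiso n.
  by have [|x _ <-] := fsurj y; [rewrite verticesT|exists x].
have S1 a : st ulim (fun=> id) (fun=> a) = a by exact: ul_cst.
have N_lim (x y : nat -> V) : (\forall k \near U, rho (x k) (y k) <= e) ->
    rho (ulim x) (ulim y) <= e by exact: metric_cvg_le (uP x) (uP y).
have T1 a : (forall n, rho a (fs n a) <= e) -> rho a (st ulim fs (fun=> a)) <= e.
  by move=> h; rewrite -{1}(ul_cst a); apply: N_lim; near=> n; exact: h.
have pp' : opp2 d m ulim (fun=> id) fs (fun=> p) (fun=> p').
  split; rewrite ?S1; apply: popp; rewrite ?(metric_refl hrho) //.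
    by apply: T1 => n; apply: qe; rewrite (pg_sym P).
  exact: T1.
split => //; pose v' i := fun _ : nat => v i.
have Tv i : rho (v i) (st ulim fs (v' i)) <= e by apply: T1 => n; exact: pe.
have Tw i : rho (w i) (st ulim fs (fun=> w i)) <= e by apply: T1 => n; exact: qe.
have sepv : separated d U ulim (fun=> id) fs (fun=> p) v'.
  split => [i|i j|i j]; first by near=> n; exact: pv.
    rewrite !S1 => vij; apply: contrapT => /vsep.
    by rewrite vij (metric_refl hrho); lra.
  move=> Tij; apply: contrapT => /vsep; have := Tv i; have := Tv j; rewrite Tij.
  have := rT (v i) (st ulim fs (v' j)) (v j); rewrite (rC (st _ _ _)); lra.
pose l1 : 'I_3 := lift ord0 ord0.
have w01 : 4 * e < rho (w ord0) (w l1) by exact: wsep.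
apply: (near_good P UU U_ne ul_le ul_odd ul_cst G H (N := fun a b => rho a b <= e)
  N_lim _ pp' sepv (i := ord0) (r := fun=> w l1)).
- by move=> x y; rewrite rC.
- move=> y vy; apply: N_lim; apply: filterS vy => n; rewrite /v' v0; exact: qe.
- by near=> n; rewrite /v' v0; exact: qw.
- move=> y; rewrite !S1 -w0 => py wy.
  have := rT (w ord0) y (w l1); have := rC y (w l1); move: w01 py wy; lra.
(* The constant 4 comes from here: [w ord0] and [w l1] are each moved by at most [e], and both
   images are within [e] of [y]. The other separations need only [2 * e]. *)
- move=> y; rewrite -w0 => Ty Tpy.
  have := Tw ord0; have := Tw l1.
  have := rT (w ord0) (st ulim fs (fun=> w ord0)) (w l1).
  have := rT (st ulim fs (fun=> w ord0)) y (w l1).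
  have := rT y (st ulim fs (fun=> w l1)) (w l1).
  have := rC y (st ulim fs (fun=> w l1)).
  have := rC (w l1) (st ulim fs (fun=> w l1)).
  move: Ty Tpy w01; lra.
Unshelve. all: by end_near. Qed.

Definition close (p q p' q' : V) (e : R) (f : V -> V) : Prop :=
  [/\ forall x, d p x = 1%N -> rho x (f x) <= e,
      forall x, d q x = 1%N -> rho x (f x) <= e,
      rho p' (f p') <= e & rho q' (f q') <= e].

Definition three_far (p q : V) (e : R) : Prop := exists v : 'I_3 -> V,
  [/\ v ord0 = q, forall i, d p (v i) = 1%N &
      forall i j, i <> j -> 4 * e < rho (v i) (v j)].

Definition still_opp (p p' : V) (e : R) : Prop :=
  forall a b, rho p a <= e -> rho p' b <= e -> d a b = m.

Definition calibrated (p q p' q' : V) (e : R) : Prop :=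
  [/\ d p q = 1%N, three_far p q e, three_far q p e, still_opp p p' e &
      still_opp q q' e].

Lemma lim_unique (I : Type) (F : set_system I) (x : I -> V) (a b : V) :
  ProperFilter F -> x @ F --> a -> x @ F --> b -> a = b.
Proof.
move=> FF xa xb; apply: (metric_cvg_unique hrho _ xa xb) => e e0.
by near=> i; rewrite (metric_refl hrho) ltW.
Unshelve. all: by end_near. Qed.

Lemma close_lim p q p' q' e (fs : nat -> V -> V) (x y : nat -> V)
    (a b a' b' : V) :
  calibrated p q p' q' e -> (forall n, complex_iso D D (fs n)) ->
  (forall n, close p q p' q' e (fs n)) -> x @ U --> a -> y @ U --> b ->
  (fun n => fs n (x n)) @ U --> a' -> (fun n => fs n (y n)) @ U --> b' ->
  a = b <-> a' = b'.
Proof.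
move=> [pq [v [v0 pv vsep]] [w [w0 qw wsep]] popp qopp] fiso fclose xa yb xa' yb'.
have qp : d q p = 1%N by rewrite (pg_sym P).
have [ulim uP [ul_le ul_odd ul_cst]] := ultra_lim UU.
have pe n : forall z, d p z = 1%N -> rho z (fs n z) <= e by have [] := fclose n.
have qe n : forall z, d q z = 1%N -> rho z (fs n z) <= e by have [] := fclose n.
have p'e n : rho p' (fs n p') <= e by have [] := fclose n.
have q'e n : rho q' (fs n q') <= e by have [] := fclose n.
have [pp' gp] :=
  near_nonprincipal fiso uP ul_cst pq v0 pv vsep w0 qw wsep pe qe p'e popp.
have [qq' gq] :=
  near_nonprincipal fiso uP ul_cst qp w0 qw wsep v0 pv vsep qe pe q'e qopp.
have G : isometries d (fun _ : nat => @id V) by split => // i z; exists z.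
have H : isometries d fs.
  split=> [n z t|n z]; first exact: iso_dist.
  have [[_ _ fsurj] _] := fiso n.
  by have [|t _ <-] := fsurj z; [rewrite verticesT|exists t].
have pqA : Adj d U (fun=> p) (fun=> q) by near=> n.
have := st_iff P UU ul_le ul_odd ul_cst G H gp gq pqA pp' x y.
rewrite /st (lim_unique _ (uP _) xa) (lim_unique _ (uP _) yb).
by rewrite (lim_unique _ (uP _) xa') (lim_unique _ (uP _) yb').
Unshelve. all: by end_near. Qed.

Lemma lim_null (x y : nat -> V) (a b : V) : x @ U --> a -> y @ U --> b ->
  (\forall n \near U, rho (x n) (y n) < n.+1%:R^-1) -> a = b.
Proof.
move=> xa yb xy; apply: (metric_cvg_unique hrho _ xa yb) => e e0.
have := U_inf (near_infty_natSinv_lt (PosNum e0)).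
by apply: filterS2 xy => n h1 h2; rewrite ltW // (lt_trans h1).
Qed.

Lemma ex_still_opp p p' : d p p' = m -> exists2 e : R, 0 < e & still_opp p p' e.
Proof.
move=> pp'; apply: contrapT => none.
have bad (n : nat) : exists ab : V * V, [/\ rho p ab.1 < n.+1%:R^-1,
    rho p' ab.2 < n.+1%:R^-1 & (d ab.1 ab.2 <= m.-1)%N].
  (* The inequalities in [still_opp] are weak and those in [bad] strict, hence the shift to
     [n.+2]. *)
  apply: contrapT => h; apply: none; exists (n.+2%:R^-1) => // a b pa p'b.
  apply/eqP; rewrite eqn_leq (pg_le P) /=; apply: contrapT => /negP nd; apply: h.
  have lt : (n.+2%:R^-1 : R) < n.+1%:R^-1 by rewrite ltf_pV2 ?posrE ?ltr_nat.
  by exists (a, b); split => /=; [exact: le_lt_trans pa lt|exact: le_lt_trans p'b lt|lia].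
have [ab abP] := choice bad.
have [a pa] := lim_ex UU (fun n => (ab n).1).
have [b pb] := lim_ex UU (fun n => (ab n).2).
have ea : p = a.
  by apply: lim_null (cvg_cst p) pa _; near=> n; have [] := abP n.
have eb : p' = b.
  by apply: lim_null (cvg_cst p') pb _; near=> n; have [] := abP n.
have : (d a b <= m.-1)%N by apply: (lim_dist UU pa pb); near=> n; have [] := abP n.
by rewrite -ea -eb pp'; have := pg_m P; lia.
Unshelve. all: by end_near. Qed.

Lemma ex_three_far p q : d p q = 1%N -> exists2 e : R, 0 < e & three_far p q e.
Proof.
move=> /triple[v [v0 pv vinj]].
have low (s : seq ('I_3 * 'I_3)) : exists2 e : R, 0 < e &
    forall i j, (i, j) \in s -> i <> j -> e <= rho (v i) (v j).
  elim: s => [|[i j] s [e e0 eP]]; first by exists 1.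
  have [ij|ij] := pselect (i = j).
    exists e => // k l; rewrite in_cons => /orP[/eqP[-> ->]//|]; exact: eP.
  have r0 : 0 < rho (v i) (v j) by apply: (metric_gt0 hrho) => /vinj.
  exists (Num.min e (rho (v i) (v j))); first by rewrite lt_min e0.
  move=> k l; rewrite in_cons ge_min => /orP[/eqP[-> ->]|kl nkl].
    by rewrite lexx orbT.
  by rewrite eP.
have [e e0 eP] := low (enum [set: 'I_3 * 'I_3]%SET).
exists (e / 5); first by rewrite divr_gt0.
exists v; split => // i j ij; have := eP i j; rewrite mem_enum inE => /(_ isT ij); lra.
Qed.

Lemma ex_calibrated p q p' q' : d p q = 1%N -> d p p' = m -> d q q' = m ->
  exists2 e : R, 0 < e & calibrated p q p' q' e.
Proof.
move=> pq pp' qq'; have qp : d q p = 1%N by rewrite (pg_sym P).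
have [e1 e10 [v [v0 pv vP]]] := ex_three_far pq.
have [e2 e20 [w [w0 qw wP]]] := ex_three_far qp.
have [e3 e30 h3] := ex_still_opp pp'; have [e4 e40 h4] := ex_still_opp qq'.
pose e := Num.min (Num.min e1 e2) (Num.min e3 e4).
have [l1 l2 l3 l4] : [/\ e <= e1, e <= e2, e <= e3 & e <= e4].
  by rewrite /e !ge_min !lexx !orbT.
exists e; first by rewrite !lt_min e10 e20 e30.
split => //.
- by exists v; split => // i j /vP; apply: le_lt_trans; rewrite ler_pM2l.
- by exists w; split => // i j /wP; apply: le_lt_trans; rewrite ler_pM2l.
- by move=> a b pa p'b; apply: h3; [exact: le_trans l3|exact: le_trans l3].
- by move=> a b pa p'b; apply: h4; [exact: le_trans l4|exact: le_trans l4].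
Qed.

(** The second implication is equicontinuity of the inverses, expressed without them. A failure of
    either one yields a sequence of maps and points whose limits contradict [close_lim]. *)
Lemma close_equicontinuous p q p' q' e eta : calibrated p q p' q' e -> 0 < eta ->
  exists2 delta, 0 < delta & forall f, complex_iso D D f ->
    close p q p' q' e f -> forall x y,
      (rho x y < delta -> rho (f x) (f y) < eta) /\
      (rho (f x) (f y) < delta -> rho x y < eta).
Proof.
move=> cal eta0; apply: contrapT => none.
have bad (n : nat) : exists t : (V -> V) * V * V, [/\ complex_iso D D t.1.1,
    close p q p' q' e t.1.1 &
    (rho t.1.2 t.2 < n.+1%:R^-1 /\ eta <= rho (t.1.1 t.1.2) (t.1.1 t.2)) \/
    (rho (t.1.1 t.1.2) (t.1.1 t.2) < n.+1%:R^-1 /\ eta <= rho t.1.2 t.2)].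
  apply: contrapT => h; apply: none; exists (n.+1%:R^-1) => // f fiso fclose x y.
  split=> xy; rewrite ltNge; apply/negP => far; apply: h.
    by exists (f, x, y); split => //; left.
  by exists (f, x, y); split => //; right.
have [t tP] := choice bad.
pose fs n := (t n).1.1; pose x n := (t n).1.2; pose y n := (t n).2.
have fiso n : complex_iso D D (fs n) by have [] := tP n.
have fclose n : close p q p' q' e (fs n) by have [] := tP n.
have [a xa] := lim_ex UU x; have [b yb] := lim_ex UU y.
have [a' xa'] := lim_ex UU (fun n => fs n (x n)).
have [b' yb'] := lim_ex UU (fun n => fs n (y n)).
have ab := close_lim cal fiso fclose xa yb xa' yb'.
have contra (z u : nat -> V) (c : V) : z @ U --> c -> u @ U --> c ->
    (\forall n \near U, eta <= rho (z n) (u n)) -> False.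
  move=> zc uc far; have near := metric_cvg_near hrho _ zc uc eta0.
  by have [n [/= h1 h2]] := filter_ex (filterI far (near _)); lra.
have [h|h] := in_ultra_setVsetC [set n | rho (x n) (y n) < n.+1%:R^-1 /\
    eta <= rho (fs n (x n)) (fs n (y n))] UU.
  have e1 : a = b by apply: lim_null xa yb _; apply: filterS h => n [].
  rewrite -(ab.1 e1) in yb'.
  by apply: contra xa' yb' _; apply: filterS h => n [].
have h' : \forall n \near U, rho (fs n (x n)) (fs n (y n)) < n.+1%:R^-1 /\
    eta <= rho (x n) (y n).
  by apply: filterS h => n /= nh; have [_ _ []] := tP n.
have e1 : a' = b' by apply: lim_null xa' yb' _; apply: filterS h' => n [].
rewrite -(ab.2 e1) in yb.
by apply: contra xa yb _; apply: filterS h' => n [].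
Qed.

Lemma cham_close (sigma : Cham D -> Cham D -> R) e :
  metric_inducing_topology sigma -> 0 < e ->
  exists2 eps, 0 < eps & forall X Y, sigma X Y <= eps ->
    rho (set_val X).1 (set_val Y).1 <= e /\ rho (set_val X).2 (set_val Y).2 <= e.
Proof.
move=> hsigma e0; apply: contrapT => none.
have bad (n : nat) : exists XY : Cham D * Cham D,
    sigma XY.1 XY.2 <= n.+1%:R^-1 /\
    ~ (rho (set_val XY.1).1 (set_val XY.2).1 <= e /\
       rho (set_val XY.1).2 (set_val XY.2).2 <= e).
  apply: contrapT => h; apply: none; exists (n.+1%:R^-1) => // X Y XY.
  by apply: contrapT => far; apply: h; exists (X, Y).
have [XY XYP] := choice bad.
have climit (X : nat -> Cham D) : exists L : Cham D, X @ U --> L.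
  have [a Xa] := lim_ex UU (fun n => (set_val (X n)).1).
  have [b Xb] := lim_ex UU (fun n => (set_val (X n)).2).
  have ab : Cham D (a, b).
    apply: (lim_Cham UU Xa Xb); near=> n; rewrite -surjective_pairing.
    exact: set_valP.
  by exists (exist _ (a, b) (mem_set ab) : Cham D); apply/Cham_cvg.
have [A XA] := climit (fun n => (XY n).1); have [B YB] := climit (fun n => (XY n).2).
have AB : A = B.
  apply: (metric_cvg_unique hsigma _ XA YB) => d0 d00.
  have := U_inf (near_infty_natSinv_lt (PosNum d00)).
  apply: filterS => n /= h; have [h1 _] := XYP n.
  by apply: le_trans h1 _; exact: ltW.
subst B; move: XA YB => /Cham_cvg[X1 X2] /Cham_cvg[Y1 Y2].
have n1 := metric_cvg_near hrho _ X1 Y1 e0; have n2 := metric_cvg_near hrho _ X2 Y2 e0.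
have [n [h1 h2]] := filter_ex (filterI (n1 _) (n2 _)).
by have [_ []] := XYP n; split; exact: ltW.
Unshelve. all: by end_near. Qed.

End nonprincipal.

Lemma cham_map_val (f : automorphism D) (X : Cham D) :
  (forall x, vtype D (f x) = vtype D x) ->
  set_val (cham_map f X) = (f (set_val X).1, f (set_val X).2).
Proof.
move=> ft; rewrite set_valE /= /cham_pair ft.
by have [_ -> _] : Cham D (set_val X) by exact: set_valP.
Qed.

Lemma cham_map_continuous (f : automorphism D) :
  (forall x, vtype D (f x) = vtype D x) -> continuous f -> continuous (cham_map f).
Proof.
move=> ft fc X; have /Cham_cvg[X1 X2] : Y @[Y --> X] --> X by exact: cvg_id.
have e1 : (fun Y : Cham D => (set_val (cham_map f Y)).1) =
    f \o (fun Y : Cham D => (set_val Y).1).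
  by apply/funext => Y; rewrite /comp cham_map_val.
have e2 : (fun Y : Cham D => (set_val (cham_map f Y)).2) =
    f \o (fun Y : Cham D => (set_val Y).2).
  by apply/funext => Y; rewrite /comp cham_map_val.
apply: (@Cham_cvg _ _ _ (nbhs X) _ (cham_map f) (cham_map f X)).2.
rewrite cham_map_val //= e1 e2; split.
  exact: cvg_comp _ _ X1 (fc _).
exact: cvg_comp _ _ X2 (fc _).
Qed.

Lemma close_chamber_maps (f : automorphism D) (C C' : Cham D) p' q' e :
  0 < e -> calibrated (set_val C).1 (set_val C).2 p' q' e ->
  in_chamber p' C' -> in_chamber q' C' ->
  (forall X, (E1 C `|` [set C']) X ->
    rho (set_val X).1 (set_val (cham_map f X)).1 <= e /\
    rho (set_val X).2 (set_val (cham_map f X)).2 <= e) ->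
  close (set_val C).1 (set_val C).2 p' q' e f /\
  forall x, vtype D (f x) = vtype D x.
Proof.
move=> e0; have : Cham D (set_val C) by exact: set_valP.
have in1 : in_chamber (set_val C).1 C by left.
have in2 : in_chamber (set_val C).2 C by right.
move: in1 in2; set p := (set_val C).1; set q := (set_val C).2.
move=> pC qC [/= pq tp tq] [_ [v [v0 pv vsep]] _ _ _] p'C' q'C' fe.
have chp x : d p x = 1%N -> exists X : Cham D, E1 C X /\ set_val X = (p, x).
  move=> /dE px; have tx : vtype D x = true.
    by have := vtypeP px; rewrite tp; case: vtype.
  have h : (p, x) \in Cham D by apply/mem_set.
  by exists (exist _ (p, x) h); split => //; exists p; split => //; left.
have chq x : d q x = 1%N -> exists X : Cham D, E1 C X /\ set_val X = (x, q).
  move=> /dE qx; have tx : vtype D x = false.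
    by have := vtypeP qx; rewrite tq; case: vtype.
  have h : (x, q) \in Cham D by apply/mem_set; split => //; exact: edge_sym.
  by exists (exist _ (x, q) h); split => //; exists q; split => //; right.
(* If [f] exchanged the types, the image of every chamber at [p] would have [f p] as its second
   vertex. All neighbours of [p] would be within [e] of [f p], although two of them are more than
   [4 * e] apart. *)
have tfp : vtype D (f p) = false.
  case tfp : (vtype D (f p)) => //; exfalso.
  have flip x : d p x = 1%N -> rho x (f p) <= e.
    move=> px; have [X [CX XE]] := chp x px; have [_] := fe X (or_introl CX).
    by rewrite set_valE /= -set_valE XE /cham_pair /= tfp.
  have := flip _ (pv ord0); have := flip _ (pv (lift ord0 ord0)).
  have := vsep ord0 (lift ord0 ord0) ltac:(by []).
  have := rT (v ord0) (f p) (v (lift ord0 ord0)).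
  have := rC (f p) (v (lift ord0 ord0)); lra.
have ft x : vtype D (f x) = vtype D x.
  have := dist_vtype (f x) (f p); rewrite (iso_dist _ _ (aut_iso f)) tfp.
  by rewrite dist_vtype tp !addbF.
split => //; split.
- move=> x px; have [X [CX XE]] := chp x px; have [_] := fe X (or_introl CX).
  by rewrite cham_map_val // XE.
- move=> x qx; have [X [CX XE]] := chq x qx; have [+ _] := fe X (or_introl CX).
  by rewrite cham_map_val // XE.
- have [] := fe C' (or_intror erefl); rewrite cham_map_val //.
  by case: p'C' => ->.
- have [] := fe C' (or_intror erefl); rewrite cham_map_val //.
  by case: q'C' => ->.
Qed.

(** * The Arzela-Ascoli argument for an ultrafilter of automorphisms *)

Section limit_automorphism.
Variables (C0 : Cham D) (F : set_system (Auttop D)) (FU : UltraFilter F).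
Hypothesis equi : forall eta, 0 < eta -> exists2 delta, 0 < delta &
  F [set f : Auttop D | forall x y,
    (rho x y < delta -> rho (f x) (f y) < eta) /\
    (rho (f x) (f y) < delta -> rho x y < eta)].
Hypothesis typed : F [set f : Auttop D | forall x, vtype D (f x) = vtype D x].

Lemma limit_auttop : exists phi : Auttop D,
  [/\ F --> phi, forall x, (fun f : Auttop D => f x) @ F --> phi x &
      forall x, vtype D (phi x) = vtype D x].
Proof.
have [inv invP] := choice (fun f : Auttop D => auttop_vert f).
have fK (f : Auttop D) : cancel f (inv f) by have [] := invP f.
have Kf (f : Auttop D) : cancel (inv f) f by have [] := invP f.
have [phi phiP] := choice (fun x => lim_ex FU (fun f : Auttop D => f x)).
have [psi psiP] := choice (fun x => lim_ex FU (fun f : Auttop D => inv f x)).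
(* Equicontinuity strengthens pointwise convergence to convergence along moving points. It makes the
   limits [phi] and [psi] of the maps and of their inverses mutually inverse, and below it gives
   convergence in the compact-open topology. *)
have phi_lim (x : Auttop D -> V) (a : V) : x @ F --> a ->
    (fun f : Auttop D => f (x f)) @ F --> phi a.
  move=> /(metric_cvg hrho) xa; apply/(metric_cvg hrho) => eta eta0.
  have eta2 : 0 < eta / 2 by rewrite divr_gt0.
  have [delta delta0 h] := equi eta2.
  have fa : F [set f : Auttop D | rho (phi a) (f a) < eta / 2].
    by move: (phiP a) => /(metric_cvg hrho); apply.
  apply: filterS3 h (xa _ delta0) fa => f /= hf xf faf.
  have := (hf a (x f)).1 xf; have := rT (phi a) (f a) (f (x f)); lra.
have psi_lim (x : Auttop D -> V) (a : V) : x @ F --> a ->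
    (fun f => inv f (x f)) @ F --> psi a.
  move=> /(metric_cvg hrho) xa; apply/(metric_cvg hrho) => eta eta0.
  have eta2 : 0 < eta / 2 by rewrite divr_gt0.
  have [delta delta0 h] := equi eta2.
  have fa : F [set f : Auttop D | rho (psi a) (inv f a) < eta / 2].
    by move: (psiP a) => /(metric_cvg hrho); apply.
  apply: filterS3 h (xa _ delta0) fa => f /= hf xf faf.
  have := (hf (inv f a) (inv f (x f))).2; rewrite !Kf => /(_ xf).
  have := rT (psi a) (inv f a) (inv f (x f)); lra.
have psiK : cancel psi phi.
  move=> y; have := phi_lim _ _ (psiP y).
  rewrite (_ : (fun f => _) = fun=> y); last by apply/funext => f; rewrite Kf.
  by move=> h; apply: lim_unique h (cvg_cst y).
have phiK : cancel phi psi.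
  move=> y; have := psi_lim _ _ (phiP y).
  rewrite (_ : (fun f => _) = fun=> y); last by apply/funext => f; rewrite fK.
  by move=> h; apply: lim_unique h (cvg_cst y).
have all x : vertices D x by rewrite verticesT.
have fE (f : Auttop D) x y : edge D x y <-> edge D (f x) (f y).
  by have [_ h] := aut_iso f; exact: h.
have phiE x y : edge D x y -> edge D (phi x) (phi y).
  move=> xy; apply: (lim_edge FU (phiP x) (phiP y)).
  by near=> f; exact: (fE f x y).1 xy.
have psiE x y : edge D x y -> edge D (psi x) (psi y).
  move=> xy; apply: (lim_edge FU (psiP x) (psiP y)).
  by near=> f; apply: (fE f _ _).2; rewrite !Kf.
have phi_iso : complex_iso D D phi.
  split; first split=> //.
  - by move=> x y _ _ e; rewrite -(phiK x) e phiK.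
  - by move=> y _; exists (psi y).
  by move=> x y _ _; split=> [/phiE//|/psiE]; rewrite !phiK.
have psi_iso : complex_iso D D psi.
  split; first split=> //.
  - by move=> x y _ _ e; rewrite -(psiK x) e psiK.
  - by move=> y _; exists (phi y).
  by move=> x y _ _; split=> [/psiE//|/phiE]; rewrite !psiK.
have phi_typed x : vtype D (phi x) = vtype D x.
  have [f [h ht]] := filter_ex (filterI (lim_vtype FU (phiP x)) typed).
  by rewrite -h ht.
have psi_typed x : vtype D (psi x) = vtype D x by rewrite -phi_typed psiK.
have phi_cont : continuous phi.
  apply: (metric_continuous hrho hrho) => eta eta0.
  have [delta delta0 h] := equi eta0; exists delta => // x y xy.
  apply: (metric_cvg_le hrho _ (phiP x) (phiP y)).
  by apply: filterS h => f /(_ x y)[hf _]; exact/ltW/hf.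
have psi_cont : continuous psi.
  apply: (metric_continuous hrho hrho) => eta eta0.
  have [delta delta0 h] := equi eta0; exists delta => // x y xy.
  apply: (metric_cvg_le hrho _ (psiP x) (psiP y)).
  by apply: filterS h => f /(_ (inv f x) (inv f y))[_]; rewrite !Kf => hf; exact/ltW/hf.
pose Phi := Automorphism phi_iso; pose Psi := Automorphism psi_iso.
have Phi_vert : homeomorphism (Phi : V -> V) by exists psi.
have Phi_cham : homeomorphism (cham_map Phi).
  exists (cham_map Psi); split; try exact: cham_map_continuous.
    move=> X; apply: val_inj; rewrite -!set_valE.
    by rewrite !cham_map_val //= !phiK -surjective_pairing.
  move=> X; apply: val_inj; rewrite -!set_valE.
  by rewrite !cham_map_val //= !psiK -surjective_pairing.
exists (MkAuttop Phi_vert Phi_cham); split => //.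
apply: (@initial_cvg _ _ _ (@auttop_map V D) F id).
apply: (iffRL (@compact_open_cvgP _ _ _ _ _)) => K O cptK oO KO.
apply: contrapT => nFO.
have {}nFO : F (~` [set f : Auttop D | auttop_map f @` K `<=` O]).
  by have [] := in_ultra_setVsetC [set f : Auttop D | auttop_map f @` K `<=` O] FU.
have bad (f : Auttop D) : exists X : Cham D,
    (* For almost all [f] this chamber is in [K] and has its image outside [O]; its limit along [F]
       is in [K], which is contradictory. [C0] is a default for the remaining [f]. *)
    ~ (auttop_map f @` K `<=` O) -> K X /\ ~ O (cham_map f X).
  have [fKO|] := pselect (auttop_map f @` K `<=` O); first by exists C0.
  move=> /existsNP[Y /not_implyP[[X KX <-] nO]]; by exists X.
have [X XP] := choice bad.
have [|L KL XL] := @ultra_cvg _ _ F K X FU cptK.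
  by apply: filterS nFO => f /XP[].
have /Cham_cvg[X1 X2] := XL.
have Phi_L : (fun f : Auttop D => cham_map f (X f)) @ F --> cham_map Phi L.
  apply: (@Cham_cvg _ _ _ F _ (fun f : Auttop D => cham_map f (X f)) _).2.
  rewrite cham_map_val //=; split.
    apply: cvg_trans (phi_lim _ _ X1); apply: near_eq_cvg.
    by apply: filterS typed => f ft; rewrite cham_map_val.
  apply: cvg_trans (phi_lim _ _ X2); apply: near_eq_cvg.
  by apply: filterS typed => f ft; rewrite cham_map_val.
have OL : nbhs (cham_map Phi L) O.
  by apply: open_nbhs_nbhs; split => //; apply: KO; exists L.
have FO : F [set f : Auttop D | O (cham_map f (X f))] := Phi_L O OL.
by have [f [/XP[_ nO] /=]] := filter_ex (filterI nFO FO).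
Unshelve. all: by end_near. Qed.

End limit_automorphism.
End compact_polygon.
Theorem corollary4 (R : realType) (V : topologicalType) (D : typed_complex V)
    (m : nat) (hD : compact_mgon D R m) (hthick : thick D) (hm : (3 <= m)%N)
    (C C' : Cham D) (hopp : opposite m C C')
    (rho : Cham D -> Cham D -> R) (hrho : metric_inducing_topology rho) :
  exists eps : R, 0 < eps /\ compact (L_set rho C C' eps).
Proof.
have [hmgon cptV [sigma hsigma] closedC] := hD.
have [d [P dE opp]] := mgon_polygon hmgon hthick hm.
have [U [UU U_inf]] := ultraFilterLemma (eventually_filter : ProperFilter \oo).
set p := (set_val C).1; set q := (set_val C).2.
have pq : d p q = 1%N by apply/dE; have [] : Cham D (set_val C) by exact: set_valP.
have [p' [q' [p'C' q'C' _ pp' qq']]] :=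
  opp C C' p q hopp (or_introl erefl) (or_intror erefl) pq.
have [e e0 cal] := ex_calibrated P dE cptV hsigma closedC UU U_inf pq pp' qq'.
have [eps eps0 epsP] := cham_close cptV hsigma closedC UU U_inf hrho e0.
exists eps; split => //.
have Lclose (f : Auttop D) : L_set rho C C' eps f ->
    close d sigma p q p' q' e f /\ forall x, vtype D (f x) = vtype D x.
  move=> Lf; apply: (close_chamber_maps P dE hsigma e0 cal p'C' q'C') => X hX.
  exact: epsP (Lf X hX).
(* [F] is an ultrafilter on the automorphism group; [U], on [nat], serves only to obtain [e], [eps]
   and the moduli of equicontinuity. *)
rewrite compact_ultra => F FU FL.
have typed : F [set f : Auttop D | forall x, vtype D (f x) = vtype D x].
  by apply: filterS FL => f /Lclose[].
have equi eta : 0 < eta -> exists2 delta : R, 0 < delta &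
    F [set f : Auttop D | forall x y,
      (sigma x y < delta -> sigma (f x) (f y) < eta) /\
      (sigma (f x) (f y) < delta -> sigma x y < eta)].
  move=> eta0; have [delta delta0 h] :=
    close_equicontinuous P dE cptV hsigma closedC UU U_inf cal eta0.
  exists delta => //; apply: filterS FL => f /Lclose[fc _] x y.
  exact: (h f (aut_iso f) fc x y).
have [phi [Fphi phix phit]] := limit_auttop P dE cptV hsigma closedC C FU equi typed.
exists phi; split => // X hX.
have lim : (fun f : Auttop D => cham_map f X) @ F --> cham_map phi X.
  apply: (@Cham_cvg _ _ _ F _ (fun f : Auttop D => cham_map f X) _).2.
  rewrite cham_map_val //=; split.
    apply: cvg_trans (phix _); apply: near_eq_cvg.
    by apply: filterS typed => f ft; rewrite cham_map_val.
  apply: cvg_trans (phix _); apply: near_eq_cvg.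
  by apply: filterS typed => f ft; rewrite cham_map_val.
apply: (metric_cvg_le hrho _ (cvg_cst X) lim).
by apply: filterS FL => f; apply.
Qed.
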